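(* Let $\Sigma$ be a finite alphabet, $\mathcal{F}\subseteq\Sigma^*$ a finite reduced set of words, and $k=\max_{\phi\in\mathcal{F}}|\phi|$. Fix a tolerance function $\xi$ with $\xi(n)\geq 2|\Sigma|^{k-1}n^{-1}$ for all $n$. For $P\in[0,1]^{\mathcal{F}}$ let $\Gamma_P$ be the set of shift-invariant probability measures $\nu$ on $\Sigma^k$ such that $\sum_{\omega\in\Sigma^k,\ \omega_0\cdots\omega_{|\phi|-1}=\phi}\nu(\omega)\leq P(\phi)$ for all $\phi\in\mathcal{F}$. Then the capacity of weak semiconstrained systems is continuous as a function of $P$ where this set is non-empty: if $\Gamma_P\neq\emptyset$, then $$\lim_{\epsilon\to 0}\overline{\mathsf{cap}}(\mathcal{F},P+\epsilon)=\overline{\mathsf{cap}}(\mathcal{F},P),$$ where the limit is over $\epsilon\in\mathbb{R}^{\mathcal{F}}$, $\epsilon\to 0$, such that $P+\epsilon\in[0,1]^{\mathcal{F}}$ and $\Gamma_{P+\epsilon}\neq\emptyset$.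
   Context: A set $\mathcal{F}$ of words is reduced if no proper (contiguous) subword of a word of $\mathcal{F}$ is in $\mathcal{F}$. For words $\tau,\omega$ with $|\tau|\leq|\omega|$, $T(\tau,\omega)=\frac{1}{|\omega|-|\tau|+1}\#\{0\leq i\leq|\omega|-|\tau| : \omega_i\cdots\omega_{i+|\tau|-1}=\tau\}$; if $|\tau|>|\omega|$, $T(\tau,\omega)=0$. The weak semiconstrained system with tolerance $\xi$ is $\overline{X}(\mathcal{F},P)=\{\omega\in\Sigma^* : \forall\phi\in\mathcal{F},\ T(\phi,\omega)\leq P(\phi)+\xi(|\omega|)\}$, where $\xi:\mathbb{N}\to\mathbb{R}^+$ satisfies $\xi(n)=o(1)$ and $\xi(n)=\Omega(1/n)$. $\overline{\mathcal{B}}_n(\mathcal{F},P)=\overline{X}(\mathcal{F},P)\cap\Sigma^n$ and $\overline{\mathsf{cap}}(\mathcal{F},P)=\limsup_{n\to\infty}\frac1n\log_2|\overline{\mathcal{B}}_n(\mathcal{F},P)|$. A probability measure $\nu$ on $\Sigma^k$ is shift invariant if $\sum_{\sigma\in\Sigma}\nu(\sigma,\sigma_1,\dots,\sigma_{k-1})=\sum_{\sigma\in\Sigma}\nu(\sigma_1,\dots,\sigma_{k-1},\sigma)$ for all $(\sigma_1,\dots,\sigma_{k-1})\in\Sigma^{k-1}$. *)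

(* Defs.v *)
From mathcomp Require Import all_boot all_order all_algebra.
From mathcomp Require Import finmap.
From mathcomp Require Import all_classical all_reals all_analysis.
Import Order.TTheory GRing.Theory Num.Theory numFieldNormedType.Exports.

Set Implicit Arguments.
Unset Strict Implicit.
Unset Printing Implicit Defensive.

Local Open Scope classical_set_scope.
Local Open Scope ring_scope.

Section SemiconstrainedSystems.
Variables (R : realType) (Sigma : finType).
Implicit Types (tau phi psi : seq Sigma) (F : {fset seq Sigma}) (xi : nat -> R).

Definition proper_subword psi phi : bool := infix psi phi && (psi != phi).

Definition reduced F : Prop :=
  forall phi psi, phi \in F -> proper_subword psi phi -> psi \notin F.

Definition max_length F : nat := \max_(phi <- F) size phi.

Definition frequency tau (w : seq Sigma) : R :=
  if (size tau <= size w)%N then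
    #|[set i : 'I_(size w - size tau).+1
         | take (size tau) (drop i w) == tau]|%:R
      / (size w - size tau).+1%:R
  else 0.

Definition tolerance xi : Prop :=
  [/\ forall n, 0 < xi n,
      xi =o_\oo (fun _ : nat => 1 : R) &
      xi \is 'Omega_\oo (fun n : nat => n%:R^-1 : R)].

Definition weak_system F xi (P : F -> R) : pred (seq Sigma) :=
  [pred w : seq Sigma | [forall phi : F, frequency (val phi) w <= P phi + xi (size w)]].

Definition weak_blocks F xi (P : F -> R) (n : nat) : {set n.-tuple Sigma} :=
  [set w : n.-tuple Sigma | tval w \in weak_system xi P].

(* Since [lne 0 = -oo], an empty set of words contributes [-oo]. *)
Definition log2e (x : \bar R) : \bar R := (lne x * ((ln 2)^-1)%:E)%E.

Definition weak_capacity F xi (P : F -> R) : \bar R :=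
  limn_esup (fun n : nat =>
    (n%:R^-1)%:E * log2e (#|weak_blocks xi P n|%:R)%:E)%E.

(* A measure on the finite set of words of length [k] is given by its values
   on points. *)
Definition probability_weights (k : nat) (nu : k.-tuple Sigma -> R) : Prop :=
  (forall w : k.-tuple Sigma, 0 <= nu w) /\ \sum_w nu w = 1.

(* For [k = 0] there are no words of length [k - 1] to range over. *)
Definition shift_invariant (k : nat) : (k.-tuple Sigma -> R) -> Prop :=
  match k with
  | 0 => fun _ => True
  | m.+1 => fun nu => forall s : m.-tuple Sigma,
      \sum_a nu [tuple of a :: s] = \sum_a nu [tuple of rcons s a]
  end.

Definition Gamma F (P : F -> R) : set ((max_length F).-tuple Sigma -> R) :=
  [set nu | [/\ probability_weights nu, shift_invariant nu &
     forall phi : F,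
       \sum_(w : (max_length F).-tuple Sigma | prefix (val phi) w) nu w <= P phi]].

Definition unit_cube F : set (F -> R) :=
  [set P | forall phi : F, 0 <= P phi <= 1].

End SemiconstrainedSystems.

(* Main.v *)
Require Import Defs.
From mathcomp Require Import all_boot all_order all_algebra.
From mathcomp Require Import finmap.
From mathcomp Require Import all_classical all_reals all_analysis.
From mathcomp Require Import zify ring lra.
Import Order.TTheory GRing.Theory Num.Theory numFieldNormedType.Exports.

(** A word of length [n + k - 1] is a walk of length [n] in the de Bruijn graph
    whose vertices are the words of length [k - 1].  The number of walks with
    prescribed edge counts [N] is, up to a polynomial factor, the exponential of
    [n] times the conditional entropy of [N / n].  The upper bound is an induction
    on the first step; the lower bound, for connected circulations, follows from
    Fleury's algorithm, which leaves all but at most one copy of one edge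
    available at each step.  Hence the capacity at [P] is the maximum of the
    entropy over the polytope [Gamma P]: every real circulation in it is
    approximated, at infinitely many lengths, by integer circulations
    (Dirichlet), and adding one copy of each edge makes these connected at a cost
    that the tolerance [2 |Sigma|^(k-1) / n] absorbs.  Finally, by Hoffman's error
    bound, [Gamma P] depends on [P] in a Lipschitz way wherever it is nonempty, and
    the entropy is Hoelder continuous, so the maximum is continuous. *)

Set Implicit Arguments.
Unset Strict Implicit.
Unset Printing Implicit Defensive.

(** * Counting walks with prescribed edge counts *)

Section Automaton.
Local Open Scope nat_scope.
Variables (V S : finType) (delta : V -> S -> V).
Implicit Types (N : {ffun V * S -> nat}) (v x r : V) (a b : S) (w : seq S).

Fixpoint run v w : V := if w is a :: w' then run (delta v a) w' else v.

Fixpoint edge_count v w : {ffun V * S -> nat} :=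
  if w is a :: w' then [ffun e => (e == (v, a)) + edge_count (delta v a) w' e]
  else [ffun=> 0].

Definition outdeg N x := \sum_a N (x, a).
Definition indeg N x := \sum_(e : V * S | delta e.1 e.2 == x) N e.
Definition remove_edge N (f : V * S) : {ffun V * S -> nat} :=
  [ffun e => N e - (e == f)].
Definition words_of n N v := #|[set w : n.-tuple S | edge_count v w == N]|.

Lemma sum_pred1 (T : finType) (P : pred T) (y : T) :
  \sum_(e | P e) (e == y) = P y :> nat.
Proof.
case: (boolP (P y)) => Py.
  rewrite (bigD1 y) //= eqxx big1 // => e /andP[_ /negbTE ->]; exact.
rewrite big1 // => e Pe; case: eqP => // ey; by rewrite -ey Pe in Py.
Qed.

Lemma sum_edge_count v w (P : pred (V * S)) a :
  \sum_(e | P e) edge_count v (a :: w) e =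
  P (v, a) + \sum_(e | P e) edge_count (delta v a) w e.
Proof.
rewrite -[X in X + _]sum_pred1 -big_split /=.
by apply: eq_bigr => e _; rewrite ffunE.
Qed.

Lemma sum_edge_countT v w : \sum_e edge_count v w e = size w.
Proof.
elim: w v => [|a w IH] v; first by rewrite big1 // => e _; rewrite ffunE.
by rewrite sum_edge_count IH.
Qed.

Lemma outdegE N x : outdeg N x = \sum_(e : V * S | e.1 == x) N e.
Proof.
rewrite /outdeg; transitivity (\sum_(y | y == x) \sum_a N (y, a)).
  by rewrite big_pred1_eq.
rewrite pair_big_dep /=; apply: eq_big => [e|[y a]] //; exact: andbT.
Qed.

Lemma sum_outdeg N : \sum_x outdeg N x = \sum_e N e.
Proof.
rewrite /outdeg pair_big /=; by apply: eq_bigr => -[].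
Qed.

(** Each step leaves one vertex and enters the next, so the contributions telescope along the walk
    and only its two ends stay unbalanced. *)
Lemma edge_count_balance v w x :
  outdeg (edge_count v w) x + (x == run v w) =
  indeg (edge_count v w) x + (x == v).
Proof.
elim: w v => [|a w IH] v /=.
  by rewrite outdegE /indeg !big1 // => e _; rewrite ffunE.
move: (IH (delta v a)); rewrite !outdegE /indeg !sum_edge_count /=.
by rewrite (eq_sym v x) (eq_sym (delta v a) x); lia.
Qed.

Lemma remove_edgeK N f : 0 < N f ->
  N = [ffun e => (e == f) + remove_edge N f e].
Proof.
move=> Nf; apply/ffunP => e; rewrite !ffunE; case: eqP => [->|] /=; lia.
Qed.

Lemma sum_remove_edge N f (P : pred (V * S)) : 0 < N f ->
  \sum_(e | P e) N e = P f + \sum_(e | P e) remove_edge N f e.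
Proof.
move=> Nf; rewrite {1}(remove_edgeK Nf) -[X in X + _]sum_pred1 -big_split /=.
by apply: eq_bigr => e _; rewrite ffunE.
Qed.

Lemma words_of0 v : words_of 0 [ffun=> 0] v = 1.
Proof.
rewrite /words_of (eq_card (B := predT)) ?card_tuple // => w.
by rewrite !inE tuple0 eqxx.
Qed.

Lemma card_tupleS n (P : pred (seq S)) :
  #|[set w : n.+1.-tuple S | P w]| =
  \sum_a #|[set w : n.-tuple S | P (a :: w)]|.
Proof.
rewrite -sum1dep_card.
under [RHS]eq_bigr do rewrite -sum1dep_card.
rewrite pair_big_dep /= (reindex (fun p : S * n.-tuple S => [tuple of p.1 :: p.2])) //=.
exists (fun w : n.+1.-tuple S => (thead w, [tuple of behead w])) => /=.
  by move=> [a w] _ /=; congr pair; apply: val_inj.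
by move=> w _; rewrite [RHS]tuple_eta; apply: val_inj.
Qed.

Lemma words_ofS n N v :
  words_of n.+1 N v =
  \sum_(a | 0 < N (v, a)) words_of n (remove_edge N (v, a)) (delta v a).
Proof.
rewrite /words_of (card_tupleS n (fun w => edge_count v w == N)).
rewrite [RHS]big_mkcond /=; apply: eq_bigr => a _.
case: ifP => Nva.
  apply: eq_card => w; rewrite !inE; apply/eqP/eqP => [<-|E].
    by apply/ffunP => e; rewrite !ffunE addKn.
  by rewrite E -remove_edgeK.
apply/eqP; rewrite cards_eq0; apply/eqP/finset.setP => w; rewrite !inE.
apply/negbTE/eqP => E; move: Nva; by rewrite -E ffunE eqxx.
Qed.

Lemma prod_fact_remove N f : 0 < N f ->
  \prod_e (N e)`! = N f * \prod_e (remove_edge N f e)`!.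
Proof.
move=> Nf; rewrite (bigD1 f) //= [X in _ = _ * X](bigD1 f) //= mulnA.
congr (_ * _).
  by rewrite ffunE eqxx subn1 -[in LHS](prednK Nf) factS prednK.
apply: eq_bigr => e ef; by rewrite ffunE (negbTE ef) subn0.
Qed.

Lemma outdeg_remove N v a x : 0 < N (v, a) ->
  outdeg (remove_edge N (v, a)) x = outdeg N x - (x == v).
Proof.
move=> Nf; rewrite !outdegE (sum_remove_edge _ Nf) /= (eq_sym v x); lia.
Qed.

Lemma prod_outdeg_remove (g : nat -> nat) N v a : 0 < N (v, a) ->
  \prod_x g (outdeg (remove_edge N (v, a)) x) =
  g (outdeg N v).-1 * \prod_(x | x != v) g (outdeg N x).
Proof.
move=> Nf; rewrite (bigD1 v) //= outdeg_remove // eqxx subn1.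
congr (_ * _); apply: eq_bigr => x xv.
by rewrite outdeg_remove // (negbTE xv) subn0.
Qed.

Lemma sum_positive N v : \sum_(a | 0 < N (v, a)) N (v, a) = outdeg N v.
Proof.
rewrite /outdeg big_mkcond; apply: eq_bigr => a _; case: ifP => //; lia.
Qed.

(** By induction on the first step. Removing a copy of [(v, a)] divides the product on the left by
    [N (v, a)] and the one on the right by [outdeg N v]; the bound reproduces itself because these
    multiplicities sum to [outdeg N v]. *)
Lemma words_of_upper n N v :
  words_of n N v * \prod_e (N e)`! <= \prod_x (outdeg N x)`!.
Proof.
elim: n N v => [|n IH] N v.
  rewrite /words_of; case: (eqVneq N [ffun=> 0]) => [->|NN].
    rewrite [X in _ * X]big1 => [|e _]; last by rewrite ffunE.
    rewrite muln1; apply: leq_trans (prodn_gt0 (fun x => fact_gt0 _)).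
    by rewrite (leq_trans (max_card _)) // card_tuple.
  rewrite (_ : [set w | _] = finset.set0) ?cards0 // ?mul0n //.
  by apply/finset.setP => w; rewrite !inE (tuple0 w) /= eq_sym (negbTE NN).
rewrite words_ofS big_distrl /=.
have [d0|d0] := posnP (outdeg N v).
  rewrite big1 // => a Na; move: d0; rewrite /outdeg (bigD1 a) //=; lia.
have -> : \prod_x (outdeg N x)`! =
    \sum_(a | 0 < N (v, a)) N (v, a) *
       ((outdeg N v).-1`! * \prod_(x | x != v) (outdeg N x)`!).
  rewrite -big_distrl /= sum_positive mulnA (bigD1 v) //=; congr (_ * _).
  by rewrite -{1}(prednK d0) factS prednK.
apply: leq_sum => a Na.
rewrite (prod_fact_remove Na) mulnCA leq_mul2l.
by rewrite -(prod_outdeg_remove (fun n => n`!) Na) IH orbT.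
Qed.

(** * Eulerian trails by Fleury's rule *)

Fixpoint supported N x w : bool :=
  if w is a :: w' then (0 < N (x, a)) && supported N (delta x a) w' else true.

(** Only the support of [N] matters here: the connecting walk may repeat an edge more often than its
    multiplicity. *)
Definition reaches N x r := exists2 w, supported N x w & run x w = r.

Lemma reaches_step N x a r :
  0 < N (x, a) -> reaches N (delta x a) r -> reaches N x r.
Proof. by move=> Na [w sw rw]; exists (a :: w) => //=; rewrite Na. Qed.

Lemma reaches_change N N' v r :
  (forall x a, x != v -> N' (x, a) = N (x, a)) -> reaches N' v r ->
  forall x, reaches N x r -> reaches N' x r.
Proof.
move=> NN' v_r x [w]; elim: w x => [|a w IH] x /=.
  by move=> _ ->; exists [::].
case/andP => Na sw rw; case: (eqVneq x v) => [-> //|xv].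
by apply: (@reaches_step _ _ a); rewrite ?NN' //; exact: IH.
Qed.

Fixpoint avoids v x w : bool :=
  (x != v) && (if w is a :: w' then avoids v (delta x a) w' else true).

(* A walk to [r] can be shortcut so as to leave [v] only once. *)
Lemma reaches_last_exit N v r : v != r -> reaches N v r ->
  exists b w, [/\ 0 < N (v, b), supported N (delta v b) w,
     run (delta v b) w = r & avoids v (delta v b) w].
Proof.
move=> vr [w sw rw].
suff H : forall w x, supported N x w -> run x w = r -> avoids v x w \/
  exists b w, [/\ 0 < N (v, b), supported N (delta v b) w,
     run (delta v b) w = r & avoids v (delta v b) w].
  by case: (H w v sw rw) => //; case: (w) => [|? ?] /=; rewrite eqxx.
elim=> [|a {sw rw}w' IH] x /=.
  by move=> _ ->; left; rewrite eq_sym vr.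
case/andP => Na sw rw; case: (IH _ sw rw) => [av|]; last by right.
  case: (eqVneq x v) => [xv|_]; last by left; rewrite av.
  by right; rewrite -xv in av *; exists a, w'.
Qed.

Lemma supported_avoids N N' v x w :
  (forall x a, x != v -> N' (x, a) = N (x, a)) -> avoids v x w ->
  supported N x w -> supported N' x w.
Proof.
move=> NN'; elim: w x => [//|a w IH] x /= /andP[xv av] /andP[Na sw].
by rewrite NN' // Na IH.
Qed.

Lemma indeg_gt0 N x a : 0 < N (x, a) -> 0 < indeg N (delta x a).
Proof. by move=> Na; rewrite /indeg (bigD1 (x, a)) //=; lia. Qed.

Lemma reaches_indeg_gt0 N x r : x != r -> reaches N x r -> 0 < indeg N r.
Proof.
move=> xr [w]; elim: w x xr => [|a w IH] x xr /=.
  by move=> _ E; rewrite E eqxx in xr.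
case/andP => Na sw rw; case: (eqVneq (delta x a) r) => [<-|ne].
  exact: indeg_gt0 Na.
exact: IH ne sw rw.
Qed.

Lemma remove_edge_off N v a x b : x != v -> remove_edge N (v, a) (x, b) = N (x, b).
Proof. by move=> xv; rewrite ffunE xpair_eqE (negbTE xv) subn0. Qed.

(** The degree condition for an Eulerian trail from [v] to [r]; for [v = r] it makes [N] a
    circulation. *)
Definition balanced N v r :=
  forall x, outdeg N x + (x == r) = indeg N x + (x == v).

Definition all_reach N r := forall x, 0 < outdeg N x -> reaches N x r.

(* Fleury's rule: at most one copy of one edge out of [v] is forbidden as the
   first step of an Eulerian trail. *)
Lemma good_first_edges N v r :
    balanced N v r -> all_reach N r -> 0 < outdeg N v ->
  exists good : pred S,
    [/\ forall a, good a ->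
          0 < N (v, a) /\ all_reach (remove_edge N (v, a)) r,
        (outdeg N v).-1 <= \sum_(a | good a) N (v, a) &
        0 < \sum_(a | good a) N (v, a)].
Proof.
move=> bal reach dv.
have mono a x : 0 < N (v, a) -> 0 < outdeg (remove_edge N (v, a)) x -> 0 < outdeg N x.
  by move=> Na; rewrite outdeg_remove //; lia.
have off a := @remove_edge_off N v a.
case: (eqVneq v r) => [vr|vr].
  exists (fun a => 0 < N (v, a)); rewrite sum_positive; split=> // [a Na|]; last lia.
  split=> // x dx; apply: reaches_change (off a) _ _ (reach x (mono _ _ Na dx)).
  by exists [::].
(* The edge [(v, b)] begins a walk to [r] that never returns to [v], so [v] stays connected to [r]
   as long as one copy of this edge is left. *)
have [b [w [Nb sw rw av]]] := reaches_last_exit vr (reach v dv).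
have vreach a : 0 < remove_edge N (v, a) (v, b) -> reaches (remove_edge N (v, a)) v r.
  move=> Nb'; apply: (@reaches_step _ _ b) => //; exists w => //.
  exact: supported_avoids (off a) av sw.
have good a : 0 < N (v, a) -> 0 < remove_edge N (v, a) (v, b) ->
    all_reach (remove_edge N (v, a)) r.
  move=> Na Nb' x dx.
  exact: reaches_change (off a) (vreach a Nb') _ (reach x (mono _ _ Na dx)).
have [d1|d1] := leqP (outdeg N v) 1.
  (* The last edge out of [v] has to be taken. By balance no edge then enters [v], so the walks from
     the other vertices to [r] do not pass through [v]. *)
  have in0 : indeg N v = 0.
    by move: (bal v); rewrite eqxx (negbTE vr); lia.
  exists (pred1 b); rewrite big_pred1_eq; split=> //; last lia.
  move=> a /eqP ->; split=> // x dx.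
  have xv : x != v.
    apply: contraTneq dx => ->; rewrite outdeg_remove // eqxx; lia.
  have [u su ru] := reach x (mono _ _ Nb dx).
  exists u => //; elim: u x {dx} xv su {ru} => [//|a' w' IH] x xv /=.
  case/andP => Na' sw'; rewrite off // Na' /=; apply: IH => //.
  by apply: contraTneq (indeg_gt0 Na') => ->; rewrite in0.
(* The edge [b] is forbidden only when a single copy of it is left, which costs exactly one unit of
   the out-degree. *)
exists (fun a => (0 < N (v, a)) && ((a != b) || (1 < N (v, b)))).
have -> : \sum_(a | (0 < N (v, a)) && ((a != b) || (1 < N (v, b)))) N (v, a)
   = outdeg N v - (N (v, b) == 1).
  case: (eqVneq (N (v, b)) 1) => [E|ne].
    rewrite E /= -sum_positive [in RHS](bigD1 b) //= E addKn; apply: eq_bigl => a.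
    by rewrite orbF andbC.
  rewrite subn0 -sum_positive; apply: eq_bigl => a.
  by rewrite (_ : 1 < _ = true) ?orbT ?andbT //; lia.
split=> [a /andP[Na ab]||]; try by case: (_ == 1) => /=; lia.
split=> //; apply: (good a Na); rewrite ffunE xpair_eqE eqxx /=.
by case/orP: ab => [/negbTE|]; [rewrite eq_sym => ->; lia | case: (_ == _); lia].
Qed.

(** The induction of [words_of_upper], restricted to good first edges: their multiplicities sum to
    at least [(outdeg N v).-1], the factor that [(outdeg N v).-1] factorial loses in this step. *)
Lemma words_of_lower n N v r :
    \sum_e N e = n -> balanced N v r -> all_reach N r ->
  \prod_x (outdeg N x).-1`! <= words_of n N v * \prod_e (N e)`!.
Proof.
elim: n N v => [|n IH] N v sN bal reach.
  have N0 : N = [ffun=> 0].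
    apply/ffunP => e; rewrite ffunE; apply/eqP; move/eqP: sN.
    by rewrite sum_nat_eq0 => /forallP/(_ e).
  rewrite N0 words_of0 mul1n big1 ?prodn_gt0 // => [e|x _]; first exact: fact_gt0.
  by rewrite outdegE big1 // => e _; rewrite ffunE.
(* If [v = r], some edge is left and its source is [r] or reaches [r]; in the latter case an edge
   enters [r], and by balance one leaves it. *)
have dv : 0 < outdeg N v.
  case: (eqVneq v r) => [vr|vr]; last first.
    by move: (bal v); rewrite eqxx (negbTE vr); lia.
  have [e Ne] : exists e, 0 < N e.
    apply/existsP; rewrite -[[exists _, _]]negbK negb_exists; apply/negP => /forallP H.
    move: sN; rewrite big1 // => e _; move: (H e); lia.
  have dx : 0 < outdeg N e.1.
    by rewrite /outdeg (bigD1 e.2) //= -surjective_pairing; lia.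
  case: (eqVneq e.1 r) => [er|er]; first by rewrite vr -er.
  by move: (reaches_indeg_gt0 er (reach _ dx)) (bal r); rewrite vr eqxx; lia.
have [good [goodP d1 d0]] := good_first_edges bal reach dv.
set R := \prod_(x | x != v) (outdeg N x).-1`!.
have le1 : \sum_(a | good a) N (v, a) * ((outdeg N v).-1.-1`! * R) <=
    words_of n.+1 N v * \prod_e (N e)`!.
  rewrite words_ofS big_distrl /= [X in X <= _]big_mkcond [X in _ <= X]big_mkcond /=.
  apply: leq_sum => a _; case: ifP => // ga.
  have [Na reach'] := goodP a ga.
  rewrite Na (prod_fact_remove Na) [X in _ <= X]mulnCA leq_mul2l; apply/orP; right.
  rewrite -(prod_outdeg_remove (fun n => n.-1`!) Na) IH //.
    by move: sN; rewrite (sum_remove_edge predT Na) /=; lia.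
  move=> x; move: (bal x); rewrite outdeg_remove // /indeg (sum_remove_edge _ Na) /=.
  rewrite (eq_sym (delta v a) x).
  case: (eqVneq x v) => [->|] /=; lia.
apply: leq_trans le1.
rewrite -big_distrl /= (bigD1 v) //= -/R mulnA leq_mul2r; apply/orP; right.
(* For out-degree at most one both factorials are [1], and the positivity [d0] of the sum is what is
   needed. *)
case: (outdeg N v) d1 => [|[|d]] d1; rewrite ?muln1 //.
by rewrite [_.-1]/= factS leq_mul2r d1 orbT.
Qed.

End Automaton.

Local Open Scope ring_scope.

(** * Hoffman's error bound *)

Section Hoffman.
Variable R : realFieldType.

Lemma ler_bigmax_seq (T : Type) (s : seq T) (P : pred T) (F : T -> R) (x0 y : R) :
  (\big[Num.max/x0]_(i <- s | P i) F i <= y) =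
  (x0 <= y) && all (fun i => P i ==> (F i <= y)) s.
Proof.
elim: s => [|i s IH]; first by rewrite big_nil andbT.
rewrite big_cons /=; case: (P i) => /=; last exact: IH.
by rewrite ge_max IH andbCA.
Qed.

(* Hoffman's error bound, uniform in the right-hand side [b].  The induction
   step eliminates the last variable by Fourier-Motzkin. *)
Lemma hoffman (d : nat) (I : finType) (A : I -> nat -> R) :
  exists2 C : R, 0 <= C & forall (b : I -> R) (y x : nat -> R) (t : R),
    0 <= t ->
    (forall i, \sum_(j < d) A i j * y j <= b i) ->
    (forall i, \sum_(j < d) A i j * x j <= b i + t) ->
    exists2 z : nat -> R, (forall i, \sum_(j < d) A i j * z j <= b i) &
      forall j : 'I_d, `|z j - x j| <= C * t.
Proof.
elim: d I A => [|d IH] I A.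
  exists 0 => // b y x t t0 yb xb; exists x => [i|[]//].
  by have := yb i; rewrite !big_ord0.
(* Rows free of the last variable are kept; rows whose last coefficients have opposite signs are
   normalised and added. All other indices carry the trivial row [0 <= 0]. *)
pose opp_sign i i' := (0 < A i d) && (A i' d < 0).
pose A' (k : I + I * I) j := match k with
  | inl i => if A i d == 0 then A i j else 0
  | inr (i, i') => if opp_sign i i' then A i j / A i d + A i' j / - A i' d else 0
  end.
pose rhs (b : I -> R) (k : I + I * I) := match k with
  | inl i => if A i d == 0 then b i else 0
  | inr (i, i') => if opp_sign i i' then b i / A i d + b i' / - A i' d else 0
  end.
have sumA' k (x : nat -> R) : \sum_(j < d) A' k j * x j =
    rhs (fun i => \sum_(j < d) A i j * x j) k.
  case: k => [i|[i i']] /=.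
    by case: ifP => // _; rewrite big1 // => j _; rewrite mul0r.
  case: ifP => [_|_]; last by rewrite big1 // => j _; rewrite mul0r.
  rewrite !mulr_suml -big_split /=; apply: eq_bigr => j _.
  by rewrite mulrDl mulrAC [X in _ + X]mulrAC.
have [C C0 HC] := IH _ A'.
pose D := 1 + \sum_i `|A i d|^-1.
have invD i : `|A i d|^-1 <= D.
  by rewrite /D (bigD1 i) //= addrCA lerDl addr_ge0 // sumr_ge0 // => *; rewrite invr_ge0.
have D0 : 0 <= D by rewrite addr_ge0 // sumr_ge0 // => *; rewrite invr_ge0.
pose B := \sum_i \sum_(j < d) `|A i j|.
have B0 : 0 <= B by rewrite sumr_ge0 // => *; rewrite sumr_ge0.
have leB i : \sum_(j < d) `|A i j| <= B.
  by rewrite /B (bigD1 i) //= lerDl sumr_ge0 // => *; rewrite sumr_ge0.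
(* A kept row is violated by at most [t], a combined one by at most [2 * D * t]. In [K], moving the
   first [d] coordinates by [C' * t] changes a row by at most [B * C' * t], and division by the last
   coefficient costs a factor [D]. *)
pose C' := C * (1 + 2 * D).
have C'0 : 0 <= C' by rewrite mulr_ge0 // addr_ge0 // mulr_ge0.
pose K := D * (1 + B * C').
have K0 : 0 <= K by rewrite mulr_ge0 // addr_ge0 // mulr_ge0.
exists (C' + K); first by rewrite addr_ge0.
move=> b y x t t0 yb xb.
have yb' k : \sum_(j < d) A' k j * y j <= rhs b k.
  rewrite sumA'; case: k => [i|[i i']] /=.
    by case: ifP => // /eqP Ai; have := yb i; rewrite big_ord_recr /= Ai mul0r addr0.
  case: ifP => // /andP[Ai Ai'].
  have := yb i; have := yb i'; rewrite !big_ord_recr /=.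
  set u := \sum_(j < d) _; set u' := \sum_(j < d) _ => h' h.
  have h1 : u' / A i d <= b i / A i d - y d.
    by rewrite -(ler_pM2r Ai) mulrBl !divfK ?gt_eqF //; lra.
  have Ai'N : 0 < - A i' d by rewrite oppr_gt0.
  have h2 : u / - A i' d <= b i' / - A i' d + y d.
    by rewrite -(ler_pM2r Ai'N) mulrDl !divfK ?gt_eqF //; lra.
  lra.
pose t' := (1 + 2 * D) * t.
have t'0 : 0 <= t' by rewrite mulr_ge0 // addr_ge0 // mulr_ge0.
have xb' k : \sum_(j < d) A' k j * x j <= rhs b k + t'.
  rewrite sumA'; case: k => [i|[i i']] /=.
    case: ifP => [/eqP Ai|_]; last by rewrite add0r.
    have := xb i; rewrite big_ord_recr /= Ai mul0r addr0 => /le_trans; apply.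
    rewrite lerD2l /t' ler_peMl //; lra.
  case: ifP => [/andP[Ai Ai']|_]; last by rewrite add0r.
  have := xb i; have := xb i'; rewrite !big_ord_recr /=.
  set u := \sum_(j < d) _; set u' := \sum_(j < d) _ => h' h.
  have Ai'N : 0 < - A i' d by rewrite oppr_gt0.
  have h1 : u' / A i d <= b i / A i d - x d + (A i d)^-1 * t.
    rewrite -(ler_pM2r Ai) mulrDl mulrBl !divfK ?gt_eqF //.
    by rewrite mulrAC mulVf ?gt_eqF //; lra.
  have h2 : u / - A i' d <= b i' / - A i' d + x d + (- A i' d)^-1 * t.
    rewrite -(ler_pM2r Ai'N) !mulrDl !divfK ?gt_eqF //.
    by rewrite (mulrAC _^-1) mulVf ?gt_eqF //; lra.
  have h3 : (A i d)^-1 * t <= D * t.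
    by rewrite ler_wpM2r // -(gtr0_norm Ai) invD.
  have h4 : (- A i' d)^-1 * t <= D * t.
    by rewrite ler_wpM2r // -(ltr0_norm Ai') invD.
  rewrite /t'; lra.
have [z' z'b z'x] := HC (rhs b) y x t' t'0 yb' xb'.
have {}z'x (j : 'I_d) : `|z' j - x j| <= C' * t.
  by rewrite /C' -mulrA; exact: z'x.
pose s i := \sum_(j < d) A i j * z' j.
pose bnd i := (b i - s i) / A i d.
have sx i : `|s i - \sum_(j < d) A i j * x j| <= B * (C' * t).
  rewrite /s -sumrB (le_trans (ler_norm_sum _ _ _)) //.
  apply: (@le_trans _ _ (\sum_(j < d) `|A i j| * (C' * t))).
    by apply: ler_sum => j _; rewrite -mulrBr normrM ler_wpM2l.
  by rewrite -mulr_suml ler_wpM2r // mulr_ge0.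
have Kt i c : 0 < c -> c = `|A i d| -> c^-1 * (t + B * (C' * t)) <= K * t.
  move=> c0 ->; rewrite (_ : K * t = D * (t + B * (C' * t))); last by rewrite /K; ring.
  apply: ler_wpM2r; last exact: invD.
  by rewrite addr_ge0 // mulr_ge0 // mulr_ge0.
have upx i : 0 < A i d -> x d - K * t <= bnd i.
  move=> Ai; have := Kt i _ Ai (esym (gtr0_norm Ai)).
  have := xb i; rewrite big_ord_recr /= => h.
  have := sx i; rewrite ler_norml => /andP[h1 h2] h3.
  have : (x d - bnd i) <= (A i d)^-1 * (t + B * (C' * t)).
    rewrite -(ler_pM2r Ai) mulrBl /bnd divfK ?gt_eqF // mulrAC mulVf ?gt_eqF //.
    lra.
  lra.
have lox i : A i d < 0 -> bnd i <= x d + K * t.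
  move=> Ai; have AiN : 0 < - A i d by rewrite oppr_gt0.
  have := Kt i _ AiN (esym (ltr0_norm Ai)).
  have := xb i; rewrite big_ord_recr /= => h.
  have := sx i; rewrite ler_norml => /andP[h1 h2] h3.
  have : (bnd i - x d) <= (- A i d)^-1 * (t + B * (C' * t)).
    rewrite -(ler_pM2r AiN) mulrBl /bnd mulrN divfK ?lt_eqF // mulrAC mulVf ?gt_eqF //.
    lra.
  lra.
have loup i i' : 0 < A i d -> A i' d < 0 -> bnd i' <= bnd i.
  move=> Ai Ai'; have := z'b (inr (i, i')); rewrite sumA' /= /opp_sign Ai Ai' /=.
  rewrite -/(s i) -/(s i') /bnd !invrN !mulrN !mulrBl; lra.
(* The last coordinate is the least value that is at least [x d - K * t] and respects all lower
   bounds. By [upx] and [loup] it respects the upper bounds, and by [lox] it is at most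
   [x d + K * t]. *)
pose zd := \big[Num.max/x d - K * t]_(i | A i d < 0) bnd i.
have zd_lo i : A i d < 0 -> bnd i <= zd.
  move=> Ai; have := lexx zd; rewrite {1}/zd ler_bigmax_seq => /andP[_ /allP].
  by move=> /(_ i (mem_index_enum i)); rewrite Ai.
have zd_up u : x d - K * t <= u -> (forall i, A i d < 0 -> bnd i <= u) -> zd <= u.
  move=> xu H; rewrite /zd ler_bigmax_seq xu; apply/allP => i _.
  by apply/implyP; exact: H.
exists (fun j => if (j < d)%N then z' j else zd) => [i|j].
  rewrite big_ord_recr /= ltnn.
  under eq_bigr do rewrite ltn_ord.
  rewrite -/(s i); case: (ltgtP (A i d) 0) => Ai.
  - have := zd_lo i Ai; rewrite /bnd ler_ndivrMr //; lra.
  - have : zd <= bnd i.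
      by apply: zd_up => [|i' Ai']; [exact: upx | exact: loup].
    rewrite /bnd ler_pdivlMr //; lra.
  - have := z'b (inl i); rewrite sumA' /= Ai eqxx -/(s i); lra.
have Ct0 : 0 <= C' * t by rewrite mulr_ge0.
have Ktt0 : 0 <= K * t by rewrite mulr_ge0.
rewrite mulrDl; case: ltnP => jd.
  by have := z'x (Ordinal jd); move=> /le_trans; apply; rewrite lerDl.
have -> : j = d :> nat by apply/eqP; rewrite eqn_leq jd -ltnS ltn_ord.
rewrite ler_norml.
have := zd_up (x d + K * t); have := zd_lo.
have : x d - K * t <= zd.
  by have := lexx zd; rewrite {1}/zd ler_bigmax_seq => /andP[].
move=> h1 _ h2; have {h2} : zd <= x d + K * t by apply: h2 => //; lra.
by move=> h2; apply/andP; split; lra.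
Qed.

Lemma hoffman_fin (J I : finType) (A : I -> J -> R) :
  exists2 C : R, 0 <= C & forall (b : I -> R) (y x : J -> R) (t : R),
    0 <= t ->
    (forall i, \sum_j A i j * y j <= b i) ->
    (forall i, \sum_j A i j * x j <= b i + t) ->
    exists2 z : J -> R, (forall i, \sum_j A i j * z j <= b i) &
      forall j, `|z j - x j| <= C * t.
Proof.
pose ext (f : J -> R) (n : nat) : R :=
  if insub n is Some i then f (enum_val (i : 'I_#|J|)) else 0.
have extE f (i : 'I_#|J|) : ext f i = f (enum_val i).
  by rewrite /ext; case: insubP => [u _ /val_inj ->|]; rewrite ?ltn_ord.
have sumE (f g : J -> R) : \sum_(i < #|J|) ext f i * ext g i = \sum_j f j * g j.
  rewrite (reindex (enum_val : 'I_#|J| -> J)) /=; last first.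
    by exists enum_rank => i _; rewrite ?enum_valK ?enum_rankK.
  by apply: eq_bigr => i _; rewrite !extE.
have [C C0 HC] := hoffman #|J| (fun i => ext (A i)).
exists C => // b y x t t0 yb xb.
have [i|i|z zb zx] := HC b (ext y) (ext x) t t0; rewrite ?sumE //.
exists (fun j => z (enum_rank j)) => [i|j]; last first.
  by have := zx (enum_rank j); rewrite extE enum_rankK.
have := zb i; congr (_ <= _).
rewrite (reindex (enum_val : 'I_#|J| -> J)) /=; last first.
  by exists enum_rank => j _; rewrite ?enum_valK ?enum_rankK.
by apply: eq_bigr => j _; rewrite extE enum_valK.
Qed.

End Hoffman.

(** * Entropy *)

Section LogEstimates.
Variable R : realType.
Implicit Types x y t : R.

Definition xlnx x := x * ln x.

Lemma ln_le_subr1 x : 0 < x -> ln x <= x - 1.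
Proof.
move=> x0; have := @le_ln1Dx R (x - 1).
by rewrite (addrC 1) subrK; apply; rewrite ltrBDl addrN.
Qed.

Lemma ln_ge_subV x : 0 < x -> 1 - x^-1 <= ln x.
Proof.
move=> x0; have := @ln_le_subr1 x^-1; rewrite invr_gt0 lnV ?posrE // => /(_ x0); lra.
Qed.

(** For [0 < x < y] and [t = y - x], the difference is [t * ln y + x * ln (y / x)]. The second term
    lies between [0] and [t]; the first is at most [0] and at least [- 2 * sqrt t], since
    [ln y >= ln t = 2 * ln (sqrt t)]. *)
Lemma xlnx_sqrt_modulus x y : 0 <= x <= 1 -> 0 <= y <= 1 ->
  `|xlnx x - xlnx y| <= 2 * Num.sqrt `|x - y|.
Proof.
wlog xy : x y / x <= y.
  move=> H x01 y01; case: (leP x y) => [|/ltW] xy; first exact: H.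
  by rewrite distrC (distrC x) H.
move=> /andP[x0 x1] /andP[y0 y1].
move: xy; rewrite le_eqVlt => /predU1P[->|xy].
  by rewrite !subrr normr0 mulr_ge0.
rewrite distrC (distrC x) [X in Num.sqrt X]gtr0_norm ?subr_gt0 //.
set t := y - x; have t0 : 0 < t by rewrite subr_gt0.
set s := Num.sqrt t; have s0 : 0 < s by rewrite sqrtr_gt0.
have st : t = s * s by rewrite -expr2 sqr_sqrtr // ltW.
have s1 : s <= 1 by rewrite -sqrtr1 ler_sqrt // /t; lra.
have ts : t <= s by rewrite st ler_piMl // ltW.
have y0' : 0 < y by lra.
have lny : ln y <= 0 by rewrite ln_le0.
have tlny : - (2 * s) <= t * ln y.
  have h1 : ln t <= ln y by rewrite ler_ln ?posrE // /t; lra.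
  have h2 : ln t = ln s + ln s by rewrite {1}st lnM ?posrE.
  have h3 := ln_ge_subV s0.
  have h4 : t * (2 - 2 * s^-1) <= t * ln y by rewrite ler_pM2l //; lra.
  have h5 : t * (2 - 2 * s^-1) = 2 * t - 2 * s.
    by rewrite mulrBr {2}st mulrCA -!mulrA mulfV ?gt_eqF // mulr1 (mulrC t).
  lra.
rewrite /xlnx ler_norml.
move: x0; rewrite le_eqVlt => /predU1P[x0|x0].
  have ty : t = y by rewrite /t -x0 subr0.
  rewrite -x0 mul0r subr0 -{1 3}ty tlny /=.
  have : t * ln y <= 0 by rewrite mulr_ge0_le0 // ltW.
  lra.
have -> : y * ln y - x * ln x = t * ln y + x * ln (y / x).
  by rewrite ln_div ?posrE // /t; ring.
have yx : 1 <= y / x by rewrite ler_pdivlMr ?mul1r // ltW.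
have h1 : 0 <= x * ln (y / x) by rewrite mulr_ge0 ?ln_ge0 // ltW.
have h2 : x * ln (y / x) <= t.
  have -> : t = x * (y / x - 1) by rewrite /t mulrBr mulrCA mulfV ?gt_eqF // !mulr1.
  by rewrite ler_pM2l // ln_le_subr1 // divr_gt0.
have h3 : t * ln y <= 0 by rewrite mulr_ge0_le0 // ltW.
by apply/andP; split; lra.
Qed.

Lemma xlnx_le0 x : x <= 1 -> xlnx x <= 0.
Proof.
move=> x1; rewrite /xlnx; case: (leP x 0) => x0; first by rewrite ln0 ?mulr0.
by rewrite mulr_ge0_le0 ?ln_le0 // ltW.
Qed.

Lemma xlnx_geN1 x : 0 <= x -> -1 <= xlnx x.
Proof.
rewrite /xlnx le_eqVlt => /predU1P[<-|x0]; first by rewrite mul0r lerN10.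
have : x * (1 - x^-1) <= x * ln x by rewrite ler_pM2l // ln_ge_subV.
by rewrite mulrBr mulfV ?gt_eqF //; lra.
Qed.

(** One half of Stirling's formula; the induction step is [m * ln (1 + 1 / m) <= 1]. *)
Lemma lnfact_ge m : xlnx m%:R - m%:R <= ln (m`!%:R : R).
Proof.
rewrite /xlnx; elim: m => [|m IH]; first by rewrite mul0r subr0 ln1.
rewrite factS natrM lnM ?posrE ?ltr0n ?fact_gt0 //.
have [->|m0] := posnP m; first by rewrite fact0 ln1; lra.
have : m%:R * (ln m.+1%:R - ln m%:R) <= (1 : R).
  have m0R : 0 < m%:R :> R by rewrite ltr0n.
  rewrite -ln_div ?posrE ?ltr0n //.
  rewrite [X in _ <= X](_ : 1 = m%:R * (m.+1%:R / m%:R - 1)); last first.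
    by rewrite mulrBr mulrCA mulfV ?gt_eqF // !mulr1 -natr1; ring.
  by rewrite ler_pM2l // ln_le_subr1 // divr_gt0 ?ltr0n.
move: IH; rewrite -natr1; set a := ln _; set b := ln (m%:R + 1); lra.
Qed.

(** The other half, up to a factor linear in [m]; the induction step is
    [(m + 1) * ln (1 + 1 / m) >= 1]. *)
Lemma lnfact_le m : ln (m`!%:R : R) <= xlnx m%:R - m%:R + 1 + ln m%:R.
Proof.
rewrite /xlnx; elim: m => [|m IH]; first by rewrite mul0r subr0 fact0 ln1 ln0 //; lra.
rewrite factS natrM lnM ?posrE ?ltr0n ?fact_gt0 //.
have [->|m0] := posnP m; first by rewrite fact0 ln1; lra.
have : 1 <= m.+1%:R * (ln m.+1%:R - ln m%:R) :> R.
  have m0R : 0 < m.+1%:R :> R by rewrite ltr0n.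
  rewrite -ln_div ?posrE ?ltr0n //.
  rewrite [X in X <= _](_ : 1 = m.+1%:R * (1 - (m.+1%:R / m%:R)^-1)); last first.
    by rewrite invf_div mulrBr mulrCA mulfV ?gt_eqF // !mulr1 -natr1; ring.
  by rewrite ler_pM2l // ln_ge_subV // divr_gt0 ?ltr0n.
move: IH; rewrite -natr1; set a := ln _; set b := ln (m%:R + 1); lra.
Qed.

Lemma ler_ln_nat m n : (m <= n)%N -> (0 < n)%N -> ln m%:R <= ln n%:R :> R.
Proof.
move=> mn n0; have [->|m0] := posnP m; first by rewrite ln0 // ln_ge0 // ler1n.
by rewrite ler_ln ?posrE ?ltr0n // ler_nat.
Qed.

Lemma ln_prodn (I : finType) (f : I -> nat) : (forall i, 0 < f i)%N ->
  ln (\prod_i f i)%:R = \sum_i ln (f i)%:R :> R.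
Proof.
move=> f0; suff : (0 < \prod_i f i)%N /\ ln (\prod_i f i)%:R = \sum_i ln (f i)%:R :> R by case.
elim/big_ind2 : _ => [|a u b w [a0 <-] [b0 <-]|i _] //; first by rewrite ln1.
by rewrite muln_gt0 a0 b0 natrM lnM ?posrE ?ltr0n.
Qed.

Lemma prod_fact_gt0 (I : finType) (f : I -> nat) : (0 < \prod_i (f i)`!)%N.
Proof. by apply: prodn_gt0 => i; exact: fact_gt0. Qed.

Lemma xlnx_div (m n : nat) : (0 < n)%N ->
  n%:R * xlnx (m%:R / n%:R) = xlnx m%:R - m%:R * ln n%:R :> R.
Proof.
move=> n0; rewrite /xlnx mulrA mulrCA mulfV ?pnatr_eq0 -?lt0n // mulr1.
have [->|m0] := posnP m; first by rewrite !mul0r subr0.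
by rewrite ln_div ?posrE ?ltr0n // mulrBr.
Qed.

Lemma log_sublinear (C e : R) : 0 <= C -> 0 < e ->
  exists n0 : nat, forall n, (n0 <= n)%N -> C * (1 + ln n%:R) <= e * n%:R.
Proof.
(* With this slope the tangent bound [ln n <= d * n - 1 - ln d] uses at most half of [e * n]; the
   other half absorbs [- C * ln d] for large [n]. *)
move=> C0 e0; pose d := e / (2 * (C + 1)).
have Cp : 0 < C + 1 by lra.
have C1 : 0 < 2 * (C + 1) by lra.
have d0 : 0 < d by rewrite divr_gt0.
pose B : R := `|C * ln d|.
exists (Num.truncn (2 * B / e)).+1 => n nn.
have n0 : 0 < n%:R :> R by rewrite ltr0n; lia.
have Bn : 2 * B <= e * n%:R.
  rewrite [e * _]mulrC -ler_pdivrMr //; apply/ltW/(lt_le_trans (truncnS_gt _)).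
  by rewrite ler_nat.
have h : ln n%:R <= d * n%:R - 1 - ln d.
  have := @ln_le_subr1 (d * n%:R); rewrite mulr_gt0 // => /(_ isT).
  by rewrite lnM ?posrE //; lra.
have h1 : C * (1 + ln n%:R) <= C * (d * n%:R - ln d).
  by rewrite ler_wpM2l //; lra.
have h2 : - (C * ln d) <= B by rewrite /B -normrN ler_norm.
have h3 : C * (d * n%:R) <= e * n%:R / 2.
  have -> : e * n%:R / 2 = (C + 1) * (d * n%:R).
    by rewrite /d; field; rewrite gt_eqF.
  by rewrite ler_wpM2r ?lerDl // mulr_ge0 // ltW.
lra.
Qed.

End LogEstimates.

Section Entropy.
Variables (R : realType) (V S : finType).
Implicit Types p q : V * S -> R.

Definition out_weight p (x : V) : R := \sum_a p (x, a).

(** The conditional entropy, in nats, of an edge given its source. *)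
Definition entropy p : R := \sum_x xlnx (out_weight p x) - \sum_e xlnx (p e).

Definition distribution_on p := (forall e, 0 <= p e) /\ \sum_e p e = 1.

Lemma sum_out_weight p : \sum_x out_weight p x = \sum_e p e.
Proof. by rewrite /out_weight pair_big /=; apply: eq_bigr => -[]. Qed.

Lemma distribution_on_le1 p e : distribution_on p -> 0 <= p e <= 1.
Proof.
move=> [p0 p1]; rewrite p0 -p1 (bigD1 e) //= lerDl sumr_ge0 //.
Qed.

Lemma out_weight_le1 p x : distribution_on p -> 0 <= out_weight p x <= 1.
Proof.
move=> [p0 p1]; have o0 y : 0 <= out_weight p y by rewrite sumr_ge0.
by rewrite o0 -p1 -sum_out_weight (bigD1 x) //= lerDl sumr_ge0.
Qed.

(** If every entry moves by at most [t], an out-weight moves by at most [|S| * t]; this is the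
    origin of [Num.sqrt #|S|]. *)
Definition entropy_modulus : R := 2 * (#|V|%:R * Num.sqrt #|S|%:R + #|{: V * S}|%:R).

Lemma entropy_modulus_ge0 : 0 <= entropy_modulus.
Proof. by rewrite mulr_ge0 // addr_ge0 // mulr_ge0. Qed.

Lemma entropy_sqrt_modulus p q t : distribution_on p -> distribution_on q ->
  (forall e, `|p e - q e| <= t) ->
  `|entropy p - entropy q| <= entropy_modulus * Num.sqrt t.
Proof.
move=> pP qP pq.
have -> : entropy p - entropy q = \sum_x (xlnx (out_weight p x) - xlnx (out_weight q x))
   - \sum_e (xlnx (p e) - xlnx (q e)).
  rewrite /entropy !sumrB; ring.
apply: le_trans (ler_normB _ _) _.
have -> : entropy_modulus * Num.sqrt t =
    \sum_(x : V) 2 * Num.sqrt (#|S|%:R * t) + \sum_(e : V * S) 2 * Num.sqrt t.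
  rewrite !sumr_const -[X in _ = X + _]mulr_natr -[X in _ = _ + X]mulr_natr.
  by rewrite sqrtrM // /entropy_modulus; ring.
apply: lerD; apply: le_trans (ler_norm_sum _ _ _) _; apply: ler_sum => x _.
  apply: le_trans (xlnx_sqrt_modulus (out_weight_le1 _ _) (out_weight_le1 _ _)) _ => //.
  rewrite ler_wpM2l // ler_wsqrtr // /out_weight -sumrB.
  apply: le_trans (ler_norm_sum _ _ _) _.
  rewrite mulr_natl -sumr_const; exact: ler_sum.
apply: le_trans (xlnx_sqrt_modulus (distribution_on_le1 _ _) (distribution_on_le1 _ _)) _ => //.
by rewrite ler_wpM2l // ler_wsqrtr.
Qed.

Lemma entropy_le p : distribution_on p -> entropy p <= #|{: V * S}|%:R.
Proof.
move=> pP; rewrite /entropy.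
have h1 : \sum_x xlnx (out_weight p x) <= 0.
  by rewrite sumr_le0 // => x _; apply: xlnx_le0; case/andP: (out_weight_le1 x pP).
have h2 : - \sum_e xlnx (p e) <= #|{: V * S}|%:R.
  rewrite -sumrN -[#|_|%:R]sumr_const; apply: ler_sum => e _.
  by rewrite lerNl xlnx_geN1 //; case: pP.
lra.
Qed.

Lemma entropy_ge0 p : distribution_on p -> 0 <= entropy p.
Proof.
move=> [p0 _]; rewrite /entropy subr_ge0.
have -> : \sum_e xlnx (p e) = \sum_x \sum_a xlnx (p (x, a)).
  by rewrite pair_big /=; apply: eq_bigr => -[].
apply: ler_sum => x _; rewrite {2}/xlnx /out_weight mulr_suml.
apply: ler_sum => a _; rewrite /xlnx.
have := p0 (x, a); rewrite le_eqVlt => /predU1P[<-|pa]; first by rewrite !mul0r.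
have le : p (x, a) <= \sum_a p (x, a) by rewrite (bigD1 a) //= lerDl sumr_ge0.
by rewrite ler_pM2l // ler_ln ?posrE // (lt_le_trans pa).
Qed.

Variable delta : V -> S -> V.
Implicit Types (N : {ffun V * S -> nat}).

Definition empirical N (n : nat) (e : V * S) : R := (N e)%:R / n%:R.

Lemma empirical_distribution N n : (0 < n)%N -> (\sum_e N e = n)%N ->
  distribution_on (empirical N n).
Proof.
move=> n0 sN; split=> [e|]; first by rewrite divr_ge0.
by rewrite -mulr_suml -natr_sum sN mulfV // pnatr_eq0 -lt0n.
Qed.

Lemma outdeg_le N x : (outdeg N x <= \sum_e N e)%N.
Proof. by rewrite -sum_outdeg (bigD1 x) //= leq_addr. Qed.

(** The terms in [ln n] cancel because out-degrees and edge counts have the same sum. *)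
Lemma entropy_empirical N n : (0 < n)%N -> (\sum_e N e = n)%N ->
  n%:R * entropy (empirical N n) =
  \sum_x xlnx (outdeg N x)%:R - \sum_e xlnx (N e)%:R.
Proof.
move=> n0 sN; rewrite /entropy mulrBr !mulr_sumr.
under eq_bigr => x _.
  rewrite (_ : out_weight _ _ = (outdeg N x)%:R / n%:R); last first.
    by rewrite /out_weight -mulr_suml -natr_sum.
  rewrite xlnx_div //; over.
under [X in _ - X]eq_bigr do rewrite xlnx_div //.
rewrite !sumrB -!mulr_suml -!natr_sum sum_outdeg; ring.
Qed.

(** Stirling's estimates applied to [words_of_upper]. The linear terms cancel, and each vertex
    leaves an error of at most [1 + ln n]. *)
Lemma words_of_le n N v : (0 < n)%N -> (\sum_e N e = n)%N ->
  (words_of delta n N v)%:R <=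
  expR (n%:R * entropy (empirical N n) + #|V|%:R * (1 + ln n%:R)) :> R.
Proof.
move=> n0 sN; have [->|W0] := posnP (words_of delta n N v); first exact: expR_ge0.
rewrite -ler_ln ?posrE ?ltr0n ?expR_gt0 // expRK entropy_empirical //.
have : ln (words_of delta n N v)%:R + \sum_e ln (N e)`!%:R <=
    \sum_x ln (outdeg N x)`!%:R :> R.
  rewrite -!ln_prodn; [|by move=> ?; exact: fact_gt0..].
  rewrite -lnM ?posrE ?ltr0n ?prod_fact_gt0 // -natrM ler_ln ?posrE ?ltr0n ?prod_fact_gt0 //.
    by rewrite ler_nat; exact: words_of_upper.
  by rewrite muln_gt0 W0 prod_fact_gt0.
have h1 : \sum_x ln (outdeg N x)`!%:R <=
    \sum_x (xlnx (outdeg N x)%:R - (outdeg N x)%:R + (1 + ln n%:R)) :> R.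
  apply: ler_sum => x _; apply: le_trans (lnfact_le _ _) _.
  by rewrite -addrA lerD2l lerD2l ler_ln_nat // -sN outdeg_le.
have h2 : \sum_e (xlnx (N e)%:R - (N e)%:R) <= \sum_e ln (N e)`!%:R :> R.
  by apply: ler_sum => e _; exact: lnfact_ge.
move: h1 h2; rewrite big_split !sumrB /= -!natr_sum sum_outdeg sumr_const.
rewrite -[_ *+ #|V|]mulr_natl; lra.
Qed.

(** Here the edges bring Stirling errors too, and at each vertex the passage from [(d - 1)!] to [d!]
    costs at most [ln n]. *)
Lemma words_of_ge n N v : (0 < n)%N -> (\sum_e N e = n)%N ->
  balanced delta N v v -> all_reach delta N v ->
  expR (n%:R * entropy (empirical N n) -
    (#|V| + #|{: V * S}|)%:R * (1 + ln n%:R)) <= (words_of delta n N v)%:R :> R.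
Proof.
move=> n0 sN bal reach.
have low := words_of_lower sN bal reach.
have W0 : (0 < words_of delta n N v)%N.
  have : (0 < words_of delta n N v * \prod_e (N e)`!)%N.
    by apply: leq_trans low; exact: prod_fact_gt0.
  by rewrite muln_gt0 => /andP[].
rewrite -ler_ln ?posrE ?ltr0n ?expR_gt0 // expRK entropy_empirical //.
have : \sum_x ln (outdeg N x).-1`!%:R <=
    ln (words_of delta n N v)%:R + \sum_e ln (N e)`!%:R :> R.
  rewrite -!ln_prodn; [|by move=> ?; exact: fact_gt0..].
  rewrite -lnM ?posrE ?ltr0n ?prod_fact_gt0 // -natrM ler_ln ?posrE ?ltr0n ?prod_fact_gt0 //.
    by rewrite ler_nat.
  by rewrite muln_gt0 W0 prod_fact_gt0.
have ln0n : 0 <= ln n%:R :> R by rewrite ln_ge0 // ler1n.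
have h1 : \sum_x (xlnx (outdeg N x)%:R - (outdeg N x)%:R - (1 + ln n%:R)) <=
   \sum_x ln (outdeg N x).-1`!%:R :> R.
  apply: ler_sum => x _.
  have := lnfact_ge R (outdeg N x).
  have [->|d0] := posnP (outdeg N x); first by rewrite fact0 ln1; lra.
  have := @ler_ln_nat R (outdeg N x) n; rewrite -{1}sN outdeg_le n0 => /(_ isT isT).
  have -> : (outdeg N x)`! = ((outdeg N x) * (outdeg N x).-1`!)%N.
    by rewrite -{1}(prednK d0) factS prednK.
  by rewrite natrM lnM ?posrE ?ltr0n ?fact_gt0 //; lra.
have h2 : \sum_e ln (N e)`!%:R <=
    \sum_e (xlnx (N e)%:R - (N e)%:R + (1 + ln n%:R)) :> R.
  apply: ler_sum => e _; apply: le_trans (lnfact_le _ _) _.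
  by rewrite -addrA lerD2l lerD2l ler_ln_nat // -sN (bigD1 e) //= leq_addr.
have cV : \sum_(x : V) (1 + ln n%:R) = #|V|%:R * (1 + ln n%:R) :> R.
  by rewrite sumr_const mulr_natl.
have cE : \sum_(e : V * S) 1 + \sum_(e : V * S) ln n%:R =
    #|{: V * S}|%:R * (1 + ln n%:R) :> R.
  by rewrite -big_split sumr_const mulr_natl.
move: h1 h2; rewrite !big_split /= !sumrN -!natr_sum sum_outdeg cV cE natrD.
lra.
Qed.

End Entropy.

(** * The polytope of circulations *)

Section SmallQuantities.
Variable R : realType.

Lemma sqrt_small (K e : R) : 0 <= K -> 0 < e ->
  exists2 d : R, 0 < d & forall t, t <= d -> K * Num.sqrt t <= e.
Proof.
move=> K0 e0; have K1 : 0 < K + 1 by lra.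
have q0 : 0 < e / (K + 1) by rewrite divr_gt0.
exists ((e / (K + 1)) ^+ 2) => [|t te]; first by rewrite exprn_gt0.
have := ler_wsqrtr te; rewrite sqrtr_sqr gtr0_norm // => h.
apply: le_trans (ler_wpM2l K0 h) _.
by rewrite mulrA ler_pdivrMr // mulrC ler_pM2l //; lra.
Qed.

Lemma divn_small (c e : R) : 0 < e ->
  exists n0 : nat, forall n, (n0 <= n)%N -> (0 < n)%N /\ c / n%:R <= e.
Proof.
move=> e0; exists (Num.truncn (c / e)).+1 => n nn.
have n0 : (0 < n)%N by lia.
split=> //; rewrite ler_pdivrMr ?ltr0n // mulrC -ler_pdivrMr //.
apply/ltW/(lt_le_trans (truncnS_gt _)); by rewrite ler_nat.
Qed.

(* Dirichlet's pigeonhole argument.  Comparing the integer parts of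
   [q * n * p e] modulo [q] replaces comparing fractional parts. *)
Lemma simultaneous_approximation (E : finType) (p : E -> R) (q M : nat) :
    (forall e, 0 <= p e) -> (0 < q)%N -> (0 < M)%N ->
  exists n (N : {ffun E -> nat}), (M <= n)%N /\
    forall e, `|(N e)%:R - n%:R * p e| < q%:R^-1.
Proof.
move=> p0; case: q => // q _ M0.
(* Only multiples of [M] are compared, so that the difference of two distinct ones is at least
   [M]. *)
pose a (i : nat) e := Num.truncn (q.+1%:R * ((i * M)%N%:R * p e)).
pose c (i : nat) := [ffun e => inord (a i e %% q.+1) : 'I_q.+1].
have [i [j [ij cij]]] : exists i j, (i < j)%N /\ c i = c j.
  have : ~~ injectiveb (fun i : 'I_(#|{ffun E -> 'I_q.+1}|).+1 => c i).
    apply/injectiveP => /leq_card; by rewrite card_ord ltnn.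
  case/injectivePn => i [j]; rewrite neq_ltn => /orP[] ij cij.
    by exists i, j.
  by exists j, i.
pose n := ((j - i) * M)%N.
pose N := [ffun e => ((a j e - a i e) %/ q.+1)%N].
exists n, N; split; first by rewrite leq_pmull // subn_gt0.
move=> e.
have arg_ge0 k : 0 <= q.+1%:R * ((k * M)%N%:R * p e) by rewrite !mulr_ge0.
have /andP[j1 j2] := truncn_itv (arg_ge0 j).
have /andP[i1 i2] := truncn_itv (arg_ge0 i).
rewrite -/(a j e) in j1 j2; rewrite -/(a i e) in i1 i2.
have aij : (a i e <= a j e)%N.
  apply: le_truncn; rewrite ler_pM2l ?ltr0n // ler_wpM2r // ler_nat.
  by rewrite leq_mul2r ltnW ?orbT.
have dvd : (q.+1 %| a j e - a i e)%N.
  have := congr1 (fun f : {ffun E -> 'I_q.+1} => val (f e)) cij.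
  rewrite !ffunE /= !inordK ?ltn_pmod // => /eqP.
  by rewrite eq_sym eqn_mod_dvd.
have NE : q.+1%:R * (N e)%:R = (a j e)%:R - (a i e)%:R :> R.
  by rewrite ffunE -natrM mulnC divnK // natrB.
have nE : q.+1%:R * (n%:R * p e) =
    q.+1%:R * ((j * M)%N%:R * p e) - q.+1%:R * ((i * M)%N%:R * p e).
  by rewrite /n mulnBl natrB ?leq_mul2r ?(ltnW ij) ?orbT //; ring.
have q0 : 0 < q.+1%:R :> R by rewrite ltr0n.
rewrite -(ltr_pM2l q0) mulfV ?gt_eqF // -[X in X * _](gtr0_norm q0) -normrM.
rewrite mulrBr NE nE ltr_norml.
move: j1 j2 i1 i2; rewrite -!natr1 => j1 j2 i1 i2.
by apply/andP; split; lra.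
Qed.

End SmallQuantities.

Section ValueFunction.
Variables (R : realType) (V S : finType) (delta : V -> S -> V).
Variables (J : finType) (A : J -> pred (V * S)).
Implicit Types (p q : V * S -> R) (P Q : J -> R).

Definition in_weight p (x : V) : R := \sum_(e : V * S | delta e.1 e.2 == x) p e.

Definition feasible P : set (V * S -> R) :=
  [set p | [/\ distribution_on p, forall x, out_weight p x = in_weight p x &
     forall j, \sum_(e | A j e) p e <= P j]]%classic.

(** Only balance and the upper bounds are relaxed; [q] stays a distribution, so that the modulus of
    the entropy applies to it. *)
Definition near_feasible P q (t : R) : Prop :=
  [/\ distribution_on q, forall x, `|out_weight q x - in_weight q x| <= t &
     forall j, \sum_(e | A j e) q e <= P j + t].

Lemma sum_indic (B : pred (V * S)) p : \sum_e (B e)%:R * p e = \sum_(e | B e) p e.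
Proof.
rewrite [RHS]big_mkcond; apply: eq_bigr => e _.
by case: (B e); rewrite ?mul1r ?mul0r.
Qed.

Lemma out_weightE p x : out_weight p x = \sum_(e : V * S | e.1 == x) p e.
Proof.
rewrite /out_weight; transitivity (\sum_(y | y == x) \sum_a p (y, a)).
  by rewrite big_pred1_eq.
rewrite pair_big_dep /=; apply: eq_big => [e|[y a]] //; exact: andbT.
Qed.

Lemma ler_signb (x t : R) : (forall b : bool, (-1) ^+ b * x <= t) <-> `|x| <= t.
Proof.
split=> [H|H b]; last first.
  apply: le_trans H; apply: le_trans (ler_norm _) _.
  by rewrite normrM normr_sign mul1r.
by rewrite ler_norml; have := H true; have := H false; rewrite /= expr0 expr1 mulN1r mul1r; lra.
Qed.

Lemma feasible_hoffman : exists2 C : R, 0 <= C & forall P p q t,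
  0 <= t -> feasible P p -> near_feasible P q t ->
  exists2 p', feasible P p' & forall e, `|p' e - q e| <= C * t.
Proof.
(* Each equality is split into two inequalities of opposite sign, indexed by [b]. The matrix does
   not involve [P], so one constant serves all [P]. *)
pose I : finType := ((V * S) + bool + (V * bool) + J)%type.
pose row (i : I) (e : V * S) : R := match i with
  | inl (inl (inl f)) => - (e == f)%:R
  | inl (inl (inr b)) => (-1) ^+ b
  | inl (inr (x, b)) => (-1) ^+ b * ((e.1 == x)%:R - (delta e.1 e.2 == x)%:R)
  | inr j => (A j e)%:R
  end.
pose rhs P (i : I) : R := match i with
  | inl (inl (inl f)) => 0
  | inl (inl (inr b)) => (-1) ^+ b
  | inl (inr (x, b)) => 0
  | inr j => P j
  end.
have sumE p i : \sum_e row i e * p e = match i with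
    | inl (inl (inl f)) => - p f
    | inl (inl (inr b)) => (-1) ^+ b * \sum_e p e
    | inl (inr (x, b)) => (-1) ^+ b * (out_weight p x - in_weight p x)
    | inr j => \sum_(e | A j e) p e
    end.
  case: i => [[[f|b]|[x b]]|j] /=; last exact: sum_indic.
  - under eq_bigr do rewrite mulNr.
    by rewrite sumrN (sum_indic (pred1 f)) big_pred1_eq.
  - by rewrite mulr_sumr.
  - rewrite out_weightE /in_weight -(sum_indic (fun e => e.1 == x)).
    rewrite -(sum_indic (fun e => delta e.1 e.2 == x)) -sumrB mulr_sumr.
    by apply: eq_bigr => e _; rewrite -mulrBl mulrA.
have [C C0 HC] := hoffman_fin row.
exists C => // P p q t t0 [[p0 p1] bal PA] [[q0 q1] qbal qA].
have [i|i|z zb zq] := HC (rhs P) p q t t0.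
- rewrite sumE; case: i => [[[f|b]|[x b]]|j] //=; first by rewrite oppr_le0.
  + by rewrite p1 mulr1.
  + by rewrite bal subrr mulr0.
- rewrite sumE; case: i => [[[f|b]|[x b]]|j] //=.
  + by rewrite add0r (le_trans _ t0) // oppr_le0.
  + by rewrite q1 mulr1 lerDl.
  + by rewrite add0r; move: b; apply/ler_signb.
exists z => //; split=> [|x|j].
- split=> [e|].
    by have := zb (inl (inl (inl e))); rewrite sumE /= oppr_le0.
  have := zb (inl (inl (inr true))); have := zb (inl (inl (inr false))).
  rewrite !sumE /= !expr0 !expr1 !mulN1r !mul1r => h1 h2.
  by apply/le_anti; rewrite h1 -lerN2.
- apply/eqP; rewrite -subr_eq0 -normr_le0; apply/ler_signb => b.
  by have := zb (inl (inr (x, b))); rewrite sumE.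
- by have := zb (inr j); rewrite sumE.
Qed.

(** The capacity in nats: [weak_capacityE] divides it by [ln 2]. *)
Definition value P : R := sup (@entropy R V S @` feasible P)%classic.

Lemma entropy_le_value P p : feasible P p -> entropy p <= value P.
Proof.
move=> fp; apply: ub_le_sup; last by exists p.
by exists #|{: V * S}|%:R => _ [q [qP _ _] <-]; exact: entropy_le.
Qed.

Lemma value_le P (c : R) : (feasible P !=set0)%classic ->
  (forall p, feasible P p -> entropy p <= c) -> value P <= c.
Proof.
move=> [p fp] H; apply: ge_sup; first by exists (entropy p), p.
by move=> _ [q fq <-]; exact: H.
Qed.

Lemma value_ge0 P : (feasible P !=set0)%classic -> 0 <= value P.
Proof.
move=> [p fp]; apply: le_trans (entropy_le_value fp).
by apply: entropy_ge0; case: fp.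
Qed.

(** Hoffman's bound moves [q] to a feasible point at distance [C * t], and the square-root modulus
    compares the entropies. *)
Lemma entropy_near_feasible : exists2 K : R, 0 <= K & forall P q t,
  0 <= t -> (feasible P !=set0)%classic -> near_feasible P q t ->
  entropy q <= value P + K * Num.sqrt t.
Proof.
have [C C0 HC] := feasible_hoffman.
exists (entropy_modulus R V S * Num.sqrt C).
  by rewrite mulr_ge0 // entropy_modulus_ge0.
move=> P q t t0 [p fp] nq.
have [p' fp' p'q] := HC P p q t t0 fp nq.
have := entropy_le_value fp'.
have [qD _ _] := nq; have [p'D _ _] := fp'.
have := entropy_sqrt_modulus p'D qD p'q.
rewrite sqrtrM // mulrA ler_norml => /andP[h _] h'; lra.
Qed.

(** A point feasible for [Q] is near feasible for [P] with error [t], and conversely. *)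
Lemma value_sqrt_modulus : exists2 K : R, 0 <= K & forall P Q t,
  0 <= t -> (feasible P !=set0)%classic -> (feasible Q !=set0)%classic ->
  (forall j, `|P j - Q j| <= t) -> `|value P - value Q| <= K * Num.sqrt t.
Proof.
have [K K0 HK] := entropy_near_feasible.
exists K => //.
suff H P Q t : 0 <= t -> (feasible P !=set0)%classic -> (feasible Q !=set0)%classic ->
    (forall j, `|P j - Q j| <= t) -> value Q <= value P + K * Num.sqrt t.
  move=> P Q t t0 fP fQ PQ; have := H P Q t t0 fP fQ PQ.
  have := H Q P t t0 fQ fP; rewrite ler_norml.
  move=> /(_ (fun j => _)) h1 h2.
  have {}h1 : value P <= value Q + K * Num.sqrt t.
    by apply: h1 => j; rewrite distrC.
  by apply/andP; split; lra.
move=> t0 fP fQ PQ; apply: value_le => // q [qD qbal qA].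
apply: HK => //; split=> // [x|j]; first by rewrite qbal subrr normr0.
apply: le_trans (qA j) _; have := PQ j; rewrite ler_norml => /andP[]; lra.
Qed.

(** With an error of at most [1 / (4 * |E|)] per edge, [E] being the set of edges, every sum of
    counts errs by at most [1/4]. Integers that differ by less than [1] are equal, so total and
    balance are exact. *)
Lemma integer_circulation p M :
    distribution_on p -> (forall x, out_weight p x = in_weight p x) -> (0 < M)%N ->
  exists n (N : {ffun V * S -> nat}),
    [/\ (M <= n)%N, (\sum_e N e = n)%N,
      forall x, outdeg N x = indeg delta N x &
      forall e, `|(N e)%:R - n%:R * p e| <= (4 * #|{: V * S}|%:R)^-1].
Proof.
move=> [p0 p1] bal M0; set c := #|{: V * S}|.
have c0 : (0 < c)%N.
  rewrite lt0n; apply/eqP => /card0_eq E0; move: p1; rewrite big1.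
    by move/esym/eqP; rewrite oner_eq0.
  by move=> e _; have := E0 e; rewrite inE.
have q0 : (0 < 4 * c)%N by rewrite muln_gt0.
have [n [N [Mn HN]]] := simultaneous_approximation p0 q0 M0.
have cR : 0 < c%:R :> R by rewrite ltr0n.
have err (B : pred (V * S)) :
    `|(\sum_(e | B e) N e)%N%:R - n%:R * \sum_(e | B e) p e| <= (4 : R)^-1.
  rewrite natr_sum mulr_sumr -sumrB; apply: le_trans (ler_norm_sum _ _ _) _.
  apply: (@le_trans _ _ (\sum_(e : V * S) (4 * c)%N%:R^-1)).
    rewrite big_mkcond; apply: ler_sum => e _; case: ifP => _; last by rewrite invr_ge0.
    exact: ltW.
  have -> : \sum_(e : V * S) (4 * c)%N%:R^-1 = c%:R * (4 * c)%N%:R^-1 :> R.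
    by rewrite sumr_const mulr_natl.
  by rewrite natrM invfM mulrCA mulfV ?gt_eqF // mulr1.
have nat_eq (a b : nat) : `|a%:R - b%:R| < 1 :> R -> a = b.
  rewrite ltr_norml => /andP[h1 h2].
  have : (a < b.+1)%N by rewrite -(ltr_nat R) -natr1; lra.
  have : (b < a.+1)%N by rewrite -(ltr_nat R) -natr1; lra.
  lia.
exists n, N; split=> // [|x|e]; last by rewrite -(natrM _ 4) ltW.
  apply: nat_eq; have := err predT; rewrite p1 mulr1 => /le_lt_trans; apply; lra.
apply: nat_eq; rewrite outdegE.
have := err [pred e | e.1 == x]; have := err [pred e | delta e.1 e.2 == x].
rewrite /= -/(in_weight p x) -out_weightE bal -/(indeg delta N x) !ler_norml ltr_norml.
move=> /andP[a1 a2] /andP[b1 b2]; apply/andP; split; lra.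
Qed.

Hypothesis strongly_connected : forall x r, exists w, run delta x w = r.
Hypothesis eulerian : forall x, (\sum_(e : V * S | delta e.1 e.2 == x) 1 = #|S|)%N.

(* Adding one copy of every edge makes an integer circulation connected, hence
   realized by words. *)
Lemma many_words p (v : V) (e : R) M :
    distribution_on p -> (forall x, out_weight p x = in_weight p x) -> 0 < e ->
  exists n (N : {ffun V * S -> nat}),
    [/\ (M <= n)%N,
      forall f, (N f)%:R <= n%:R * p f + 1 + (4 * #|{: V * S}|%:R)^-1 &
      expR ((n + #|{: V * S}|)%:R * (entropy p - e)) <=
        (words_of delta (n + #|{: V * S}|) N v)%:R :> R].
Proof.
move=> pD bal e0; set c := #|{: V * S}|.
have e20 : 0 < e / 2 by rewrite divr_gt0.
have [d d0 Hd] := sqrt_small (entropy_modulus_ge0 R V S) e20.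
(* The numerator [2 + c] bounds the deviation of a count from [(n + c) * p f]: [1] for the added
   copy, at most [1] for rounding, and at most [c] for the longer length. *)
have [n1 Hn1] := divn_small (2 + c%:R) d0.
have [n2 Hn2] := log_sublinear (ler0n R (#|V| + c)) e20.
have [n [N [Mn sN balN HN]]] := integer_circulation pD bal (ltn0Sn (M + n1 + n2)).
pose N' : {ffun V * S -> nat} := [ffun f => (N f + 1)%N].
have NE f : (N f)%:R <= n%:R * p f + (4 * c%:R)^-1.
  by have := HN f; rewrite -/c ler_norml => /andP[]; lra.
exists n, N'; split=> [|f|]; first lia.
  by rewrite ffunE natrD; have := NE f; lra.
have n'0 : (0 < n + c)%N by lia.
have sN' : (\sum_f N' f = n + c)%N.
  under eq_bigr do rewrite ffunE.
  by rewrite big_split /= sN sum1_card.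
have bal' : balanced delta N' v v.
  move=> x; congr addn; rewrite outdegE /indeg.
  under eq_bigr do rewrite ffunE.
  under [RHS]eq_bigr do rewrite ffunE.
  rewrite !big_split /= -outdegE balN -/(indeg delta N x); congr addn.
  rewrite eulerian; transitivity (outdeg [ffun _ : V * S => 1%N] x).
    by rewrite outdegE; apply: eq_bigr => f _; rewrite ffunE.
  by rewrite /outdeg; under eq_bigr do rewrite ffunE; rewrite sum1_card.
have reach' : all_reach delta N' v.
  move=> x _; have [w <-] := strongly_connected x v.
  exists w => //; elim: w x => [//|a w IH] x /=.
  by rewrite ffunE addn1 /= IH.
apply: le_trans (words_of_ge _ n'0 sN' bal' reach').
rewrite ler_expR.
have [n'1 Hd'] : (0 < n + c)%N /\ (2 + c%:R) / (n + c)%:R <= d by apply: Hn1; lia.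
have n'R : 0 < (n + c)%:R :> R by rewrite ltr0n.
have close f : `|empirical R N' (n + c) f - p f| <= (2 + c%:R) / (n + c)%:R.
  have c1 : (4 * c%:R)^-1 <= 1 :> R.
    have c0 : (0 < c)%N by apply/card_gt0P; exists f.
    by rewrite invf_le1 ?mulr_gt0 ?ltr0n // -natrM ler1n muln_gt0 c0.
  have -> : empirical R N' (n + c) f - p f = ((N' f)%:R - (n + c)%:R * p f) / (n + c)%:R.
    by rewrite /empirical mulrBl mulrAC mulfV ?gt_eqF // mul1r.
  rewrite normrM [X in _ * X]gtr0_norm ?invr_gt0 // ler_wpM2r ?invr_ge0 ?ler0n //.
  rewrite ffunE !natrD.
  have /andP[p0 p1] := distribution_on_le1 f pD.
  have cp0 : 0 <= c%:R * p f by rewrite mulr_ge0.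
  have cp1 : c%:R * p f <= c%:R by rewrite ler_piMr.
  have := HN f; rewrite -/c ler_norml => /andP[h1 h2].
  by rewrite ler_norml; apply/andP; split; lra.
have := entropy_sqrt_modulus (empirical_distribution R n'0 sN') pD close.
move=> /le_trans /(_ (Hd _ Hd')); rewrite ler_norml => /andP[h _].
have h2 : (#|V| + c)%:R * (1 + ln (n + c)%:R) <= e / 2 * (n + c)%:R.
  by apply: Hn2; lia.
have h3 : (n + c)%:R * (entropy p - e / 2) <=
    (n + c)%:R * entropy (empirical R N' (n + c)).
  by rewrite ler_pM2l //; lra.
lra.
Qed.

End ValueFunction.

(** * Words as walks in the de Bruijn graph *)

Section DeBruijn.
Variables (Sigma : finType) (m : nat).
Implicit Types (x v : m.-tuple Sigma) (a : Sigma) (w phi : seq Sigma).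
Local Notation E := (m.-tuple Sigma * Sigma)%type.

Definition shift x a : m.-tuple Sigma := [tuple of behead (rcons x a)].

Definition edge_word (e : E) : m.+1.-tuple Sigma := [tuple of rcons e.1 e.2].

(** The edge into [x] whose word is [a :: x]. The form with [belast] and [last] also covers
    [m = 0]. *)
Definition in_edge x a : E := ([tuple of belast a x], last a x).

Lemma edge_word_in_edge x a : edge_word (in_edge x a) = a :: x :> seq Sigma.
Proof. by rewrite /= -lastI. Qed.

Lemma edge_word_inj : injective edge_word.
Proof.
move=> [x a] [y b] /(congr1 val) /= /rcons_inj [xy ->]; congr pair; exact: val_inj.
Qed.

(** An edge into [x] is determined by the letter that the shift drops; this turns in-weights into
    the left-hand sums of shift invariance. *)
Lemma sum_in_edge (T : nmodType) (f : E -> T) x :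
  \sum_(e : E | shift e.1 e.2 == x) f e = \sum_a f (in_edge x a).
Proof.
have shiftK a : shift (in_edge x a).1 (in_edge x a).2 = x.
  by apply: val_inj; rewrite /= -lastI.
rewrite (reindex (in_edge x)) /=.
  by apply: eq_bigl => a; rewrite shiftK eqxx.
exists (fun e : E => thead (edge_word e)) => [a _|e /eqP ex].
  by rewrite /thead (tnth_nth a) [X in nth _ X]edge_word_in_edge.
apply: edge_word_inj; apply: val_inj; rewrite [LHS]edge_word_in_edge -ex.
exact: esym (congr1 val (tuple_eta (edge_word e))).
Qed.

Lemma shift_eulerian x : (\sum_(e : E | shift e.1 e.2 == x) 1 = #|Sigma|)%N.
Proof. by rewrite (sum_in_edge (fun=> 1%N)) sum1_card. Qed.

Lemma shift_cat x a w : shift x a ++ w = behead (x ++ a :: w).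
Proof. by rewrite /= -cat_rcons; case: (rcons x a) (size_rcons x a). Qed.

Lemma run_shift x w : run shift x w = drop (size w) (x ++ w) :> seq Sigma.
Proof.
elim: w x => [|a w IH] x; first by rewrite cats0 drop0.
by rewrite [LHS]IH shift_cat -drop1 drop_drop addn1.
Qed.

Lemma shift_connected x r : exists w, run shift x w = r.
Proof.
exists r; apply: val_inj; rewrite /= run_shift drop_size_cat //.
by rewrite !size_tuple.
Qed.

(** The number of starting positions is a parameter because a word shorter than [m.+1] can also
    start after the last window of length [m.+1]. *)
Definition occurrences phi w (n : nat) : nat := \sum_(i < n) prefix phi (drop i w).

(** The edge at step [i] of the walk carries the window of length [m.+1] at position [i], which is
    long enough to show whether [phi] starts there. *)
Lemma sum_edge_count_prefix phi v w : (size phi <= m.+1)%N ->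
  (\sum_(e : E | prefix phi (edge_word e)) edge_count shift v w e)%N =
  occurrences phi (v ++ w) (size w).
Proof.
move=> phim; elim: w v => [|a w IH] v.
  by rewrite /occurrences big_ord0 big1 // => e _; rewrite ffunE.
rewrite sum_edge_count IH /occurrences big_ord_recl; congr addn; last first.
  by apply: eq_bigr => i _; rewrite shift_cat -drop1 drop_drop addn1.
congr nat_of_bool; rewrite drop0 /= -cat_rcons !prefixE.
rewrite take_cat size_rcons size_tuple; case: ltnP => // h.
have -> : size phi = m.+1 by apply/eqP; rewrite eqn_leq phim h.
by rewrite subnn take0 cats0 take_oversize // size_rcons size_tuple.
Qed.

Lemma occurrences_leD phi w n j :
  (occurrences phi w n <= occurrences phi w (n + j) <= occurrences phi w n + j)%N.
Proof.
rewrite /occurrences big_split_ord /= leq_addr leq_add2l /=.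
apply: (@leq_trans (\sum_(i < j) 1)); last by rewrite sum1_card card_ord.
by apply: leq_sum => i _; exact: leq_b1.
Qed.

Lemma card_prefix_edges phi : (size phi <= m.+1)%N ->
  (#|[pred e : E | prefix phi (edge_word e)]| <= #|Sigma| ^ (m.+1 - size phi))%N.
Proof.
move=> phim; rewrite -card_tuple.
pose f (e : E) : (m.+1 - size phi).-tuple Sigma := [tuple of drop (size phi) (edge_word e)].
rewrite -(card_in_imset (f := f)) ?max_card // => e e'.
rewrite !inE !prefixE => /eqP h /eqP h' /(congr1 val) /= ff.
apply: edge_word_inj; apply: val_inj.
rewrite -[LHS](cat_take_drop (size phi)) -[RHS](cat_take_drop (size phi)).
congr cat; [exact: etrans h (esym h') | exact: ff].
Qed.

Variable R : realType.

Lemma frequencyE phi w : (size phi <= size w)%N ->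
  frequency R phi w = (occurrences phi w (size w - size phi).+1)%:R / (size w - size phi).+1%:R.
Proof.
move=> h; rewrite /frequency h; congr (_%:R / _).
rewrite /occurrences -sum1_card [LHS]big_mkcond; apply: eq_bigr => i _.
rewrite unfold_in /= asboolb prefixE; by case: (_ == _).
Qed.

End DeBruijn.

(** * Upper limits and logarithmic growth rates *)

Section Limsup.
Variable R : realType.

Lemma limn_esup_le (u : nat -> \bar R) (c : \bar R) (n0 : nat) :
  (forall n, (n0 <= n)%N -> (u n <= c)%E) -> (limn_esup u <= c)%E.
Proof.
move=> H; rewrite /limn_esup /limf_esup.
pose V := [set n | (n0 <= n)%N]%classic.
apply: (@le_trans _ _ (ereal_sup (u @` V)%classic)).
  by apply: ereal_inf_lbound; exists V => //; exists n0.
by apply: ge_ereal_sup => _ [n Vn <-]; exact: H.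
Qed.

Lemma limn_esup_ge (u : nat -> \bar R) (c : \bar R) :
  (forall n0, exists2 n, (n0 <= n)%N & (c <= u n)%E) -> (c <= limn_esup u)%E.
Proof.
move=> H; rewrite /limn_esup /limf_esup; apply: le_ereal_inf_tmp => _ [V [n0 _ n0V] <-].
have [n n0n cu] := H n0.
by apply: (le_trans cu); apply: ereal_sup_ubound; exists n => //; exact: n0V.
Qed.

Lemma log2_rate_le (k n : nat) (c : R) : (0 < n)%N -> k%:R <= expR (n%:R * c) ->
  ((n%:R^-1)%:E * log2e (k%:R)%:E <= (c / ln 2)%:E)%E.
Proof.
move=> n0 kc; have ln2 : 0 < ln 2 :> R by rewrite ln_gt0 // ltr1n.
have nR : 0 < n%:R :> R by rewrite ltr0n.
(* For [k = 0] the rate is [-oo]. *)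
rewrite /log2e; have [->|k0] := posnP k.
  rewrite le0_lneNy // gt0_mulNye ?lte_fin ?invr_gt0 //.
  by rewrite gt0_muleNy ?lte_fin ?invr_gt0 // leNye.
rewrite lne_EFin ?ltr0n // -!EFinM lee_fin mulrA ler_pM2r ?invr_gt0 //.
rewrite mulrC ler_pdivrMr // mulrC -[leRHS]expRK ler_ln ?posrE ?ltr0n ?expR_gt0 //.
Qed.

Lemma log2_rate_ge (k n : nat) (c : R) : (0 < n)%N -> expR (n%:R * c) <= k%:R ->
  ((c / ln 2)%:E <= (n%:R^-1)%:E * log2e (k%:R)%:E)%E.
Proof.
move=> n0 kc; have ln2 : 0 < ln 2 :> R by rewrite ln_gt0 // ltr1n.
have nR : 0 < n%:R :> R by rewrite ltr0n.
have k0 : 0 < k%:R :> R by apply: lt_le_trans kc; exact: expR_gt0.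
rewrite /log2e lne_EFin // -!EFinM lee_fin mulrA ler_pM2r ?invr_gt0 //.
rewrite [leRHS]mulrC ler_pdivlMr // mulrC -[leLHS]expRK ler_ln ?posrE ?expR_gt0 //.
Qed.

End Limsup.

Lemma card_tuple_cat (S : finType) (m n : nat) (Q : pred (seq S)) :
  #|finset (fun u : (m + n).-tuple S => Q u)| =
  (\sum_(v : m.-tuple S) #|finset (fun w : n.-tuple S => Q (v ++ w))|)%N.
Proof.
rewrite -sum1dep_card.
under [RHS]eq_bigr do rewrite -sum1dep_card.
rewrite pair_big_dep /=.
pose f (p : m.-tuple S * n.-tuple S) := [tuple of p.1 ++ p.2].
rewrite (reindex f) //=; apply: onW_bij; apply: inj_card_bij.
  move=> [v w] [v' w'] /(congr1 val) /= /eqP.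
  by rewrite eqseq_cat ?size_tuple // => /andP[/eqP/val_inj -> /eqP/val_inj ->].
by rewrite card_prod !card_tuple expnD.
Qed.

(** * Counting the blocks of a weak semiconstrained system *)

Section Blocks.
Variables (R : realType) (Sigma : finType) (F : {fset seq Sigma}) (m : nat).
Variable xi : nat -> R.
Hypothesis F_size : forall phi : F, (0 < size (fsval phi) <= m.+1)%N.
(** This can fail only over an alphabet of at most one letter, where reducedness makes all words of
    [F] equally long. *)
Hypothesis F_room : forall phi : F,
  ((m.+1 - size (fsval phi)).+1 <= #|Sigma| ^ (m.+1 - size (fsval phi)))%N.
Hypothesis xi_ge : forall n : nat, (0 < n)%N ->
  2 * #|Sigma|%:R ^+ m * n%:R^-1 <= xi n.
Hypothesis xi_small : forall e : R, 0 < e ->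
  exists n0 : nat, forall n, (n0 <= n)%N -> xi n <= e.

Local Notation V := (m.-tuple Sigma).
Local Notation E := (m.-tuple Sigma * Sigma)%type.
Implicit Types (P : F -> R) (v : V) (w : seq Sigma).

Definition begins_with (phi : F) : pred E := fun e => prefix (fsval phi) (edge_word e).

Let feas P := feasible (@shift Sigma m) begins_with P.
Let val_ P := value (@shift Sigma m) begins_with P.

Lemma weak_system_cat P v w : (0 < size w)%N ->
  reflect (forall phi : F,
      (occurrences (fsval phi) (v ++ w) (size w + (m.+1 - size (fsval phi))))%:R <=
      (size w + (m.+1 - size (fsval phi)))%:R * (P phi + xi (m + size w)))
    (weak_system xi P (v ++ w)).
Proof.
move=> w0.
have freq_le phi : (frequency R (fsval phi) (v ++ w) <= P phi + xi (size (v ++ w))) =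
    ((occurrences (fsval phi) (v ++ w) (size w + (m.+1 - size (fsval phi))))%:R <=
      (size w + (m.+1 - size (fsval phi)))%:R * (P phi + xi (m + size w))).
  have /andP[phi0 phim] := F_size phi.
  have h : (size (fsval phi) <= size (v ++ w))%N by rewrite size_cat size_tuple; lia.
  rewrite frequencyE // size_cat size_tuple.
  have -> : ((m + size w) - size (fsval phi)).+1 = (size w + (m.+1 - size (fsval phi)))%N.
    by lia.
  by rewrite ler_pdivrMr ?ltr0n ?addn_gt0 ?w0 // mulrC.
by apply: (iffP forallP) => H phi; have := H phi; rewrite freq_le.
Qed.

Lemma words_of_le_blocks P n N v :
  (forall w : n.-tuple Sigma, edge_count (@shift Sigma m) v w = N ->
     weak_system xi P (v ++ w)) ->
  (words_of (@shift Sigma m) n N v <= #|weak_blocks xi P (m + n)|)%N.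
Proof.
move=> H; rewrite /weak_blocks (card_tuple_cat _ _ (weak_system xi P)) (bigD1 v) //=.
apply: leq_trans _ (leq_addr _ _); apply: subset_leq_card; apply/fintype.subsetP => w.
by rewrite !inE => /eqP; exact: H.
Qed.

(** The method of types: there are at most [(n + 1)^|E|] vectors of edge counts. *)
Lemma card_by_types n v (Q : pred (n.-tuple Sigma)) (B : R) : 0 <= B ->
  (forall w : n.-tuple Sigma, Q w ->
     (words_of (@shift Sigma m) n (edge_count (@shift Sigma m) v w) v)%:R <= B) ->
  #|finset Q|%:R <= n.+1%:R ^+ #|{: E}| * B.
Proof.
move=> B0 H.
pose f (w : n.-tuple Sigma) : {ffun E -> 'I_n.+1} :=
  [ffun e => inord (edge_count (@shift Sigma m) v w e)].
have fE (w w' : n.-tuple Sigma) : f w = f w' ->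
    edge_count (@shift Sigma m) v w = edge_count (@shift Sigma m) v w'.
  have bnd (u : n.-tuple Sigma) e : (edge_count (@shift Sigma m) v u e < n.+1)%N.
    rewrite ltnS -[leqRHS](size_tuple u) -(sum_edge_countT (@shift Sigma m) v).
    by rewrite (bigD1 e) //= leq_addr.
  move=> ff; apply/ffunP => e; have := congr1 (fun g : {ffun E -> 'I_n.+1} => val (g e)) ff.
  by rewrite !ffunE /= !inordK.
rewrite -sum1_card (partition_big f predT) //= natr_sum.
have -> : n.+1%:R ^+ #|{: E}| * B = \sum_(y : {ffun E -> 'I_n.+1}) B.
  by rewrite -natrX mulr_natl sumr_const card_ffun card_ord.
apply: ler_sum => y _; rewrite sum1dep_card.
have [-> |[w]] := set_0Vmem (finset (fun w : n.-tuple Sigma => (w \in finset Q) && (f w == y))).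
  by rewrite cards0.
rewrite !inE => /andP[Qw /eqP fw].
apply: le_trans (H w Qw); rewrite ler_nat; apply: subset_leq_card.
by apply/fintype.subsetP => w'; rewrite !inE => /andP[_ /eqP fw']; apply/eqP/fE; rewrite fw fw'.
Qed.

Lemma xi_ge0 n : (0 < n)%N -> 0 <= xi n.
Proof. by move=> n0; apply: le_trans (xi_ge n0); rewrite !mulr_ge0 ?exprn_ge0 // invr_ge0. Qed.

(** The ends of the walk unbalance it by at most [1 / n]. The [j <= m] starting positions beyond the
    [n] edges cost at most [m / n] in the bound and multiply the tolerance by at most [m + 1]. *)
Lemma near_feasible_empirical P v n (w : n.-tuple Sigma) : (0 < n)%N ->
    unit_cube P -> weak_system xi P (v ++ w) ->
  near_feasible (@shift Sigma m) begins_with P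
    (empirical R (edge_count (@shift Sigma m) v w) n)
    (xi (m + n) * (m%:R + 2) + (m%:R + 1) / n%:R).
Proof.
move=> n0 Pcube; have w0 : (0 < size w)%N by rewrite size_tuple.
move=> /(weak_system_cat P v w0); rewrite size_tuple => H.
have nR : 0 < n%:R :> R by rewrite ltr0n.
have xi0 : 0 <= xi (m + n) by apply: xi_ge0; lia.
have inv0 : 0 <= n%:R^-1 :> R by rewrite invr_ge0.
have inv1 : n%:R^-1 <= (m%:R + 1) / n%:R :> R by rewrite ler_peMl // lerDr.
have xim0 : 0 <= xi (m + n) * (m%:R + 2) by rewrite mulr_ge0 // addr_ge0.
split=> [|x|phi].
- by apply: empirical_distribution => //; rewrite sum_edge_countT size_tuple.
- rewrite /out_weight /in_weight -!mulr_suml -!natr_sum -mulrBl normrM.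
  rewrite [X in _ * X]gtr0_norm ?invr_gt0 //.
  have := edge_count_balance (@shift Sigma m) v w x.
  rewrite -/(outdeg (edge_count (@shift Sigma m) v w) x).
  rewrite -/(indeg (@shift Sigma m) (edge_count (@shift Sigma m) v w) x).
  move=> /(congr1 (fun k => k%:R : R)); rewrite !natrD => h.
  have le1 : `|(outdeg (edge_count (@shift Sigma m) v w) x)%:R -
      (indeg (@shift Sigma m) (edge_count (@shift Sigma m) v w) x)%:R| <= 1 :> R.
    by rewrite ler_norml; move: h; case: (_ == _); case: (_ == _) => /= h;
      apply/andP; split; lra.
  by apply: le_trans (ler_wpM2r inv0 le1) _; rewrite mul1r; lra.
have /andP[phi0 phim] := F_size phi.
rewrite -mulr_suml -natr_sum sum_edge_count_prefix // size_tuple ler_pdivrMr //.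
set j := (m.+1 - size (fsval phi))%N.
have /andP[le1 _] := occurrences_leD (fsval phi) (v ++ w) n j.
apply: (@le_trans _ _ (occurrences (fsval phi) (v ++ w) (n + j))%:R); first by rewrite ler_nat.
apply: le_trans (H phi) _; rewrite -/j.
have /andP[P0 P1] := Pcube phi.
have jm : j%:R <= m%:R :> R by rewrite ler_nat /j; lia.
have h1 : j%:R * P phi <= m%:R by rewrite (le_trans _ jm) // ler_piMr.
have h2 : j%:R * xi (m + n) <= n%:R * m%:R * xi (m + n).
  rewrite ler_wpM2r // (le_trans jm) // ler_peMl // ler1n //.
have h3 : 0 <= n%:R * xi (m + n) by rewrite mulr_ge0.
have -> : (P phi + (xi (m + n) * (m%:R + 2) + (m%:R + 1) / n%:R)) * n%:R =
  n%:R * P phi + n%:R * m%:R * xi (m + n) + 2 * (n%:R * xi (m + n)) + m%:R + 1.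
  by field; rewrite gt_eqF.
rewrite natrD; lra.
Qed.

Lemma blocks_upper P (e : R) : unit_cube P -> (feas P !=set0)%classic -> 0 < e ->
  exists n0, forall n, (n0 <= n)%N ->
    #|weak_blocks xi P n|%:R <= expR (n%:R * (val_ P + e)).
Proof.
move=> Pcube fP e0.
have [K K0 HK] := entropy_near_feasible R (@shift Sigma m) begins_with.
have e4 : 0 < e / 4 by rewrite divr_gt0.
have [d d0 Hd] := sqrt_small K0 e4.
have d2 : 0 < d / 2 by rewrite divr_gt0.
have dm : 0 < d / (2 * (m%:R + 2)) by rewrite divr_gt0 // mulr_gt0 // ltr_wpDl.
have [n1 Hn1] := xi_small dm.
have [n2 Hn2] := divn_small (m%:R + 1) d2.
(* The constant collects the choice of the initial vertex, the Stirling errors at the vertices, and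
   the number of types. *)
have [n3 Hn3] := log_sublinear (ler0n R (2 * #|{: V}| + #|{: E}|)) e4.
exists (n1 + n2 + n3 + m).+1 => L LL.
have [n Ln] : exists n, L = (m + n)%N by exists (L - m)%N; lia.
have [n0 n1L n2n n3L nL] : [/\ (0 < n)%N, (n1 <= L)%N, (n2 <= n)%N, (n3 <= L.+1)%N & (n <= L)%N].
  by split; lia.
have L0 : (0 < L)%N := leq_trans n0 nL.
have val0 : 0 <= val_ P by exact: value_ge0.
pose t := xi L * (m%:R + 2) + (m%:R + 1) / n%:R.
have t0 : 0 <= t.
  by rewrite addr_ge0 ?divr_ge0 ?mulr_ge0 ?addr_ge0 // xi_ge0.
have td : t <= d.
  have [_ h2] := Hn2 n n2n.
  have h1 := Hn1 L n1L.
  have m2 : 0 < m%:R + 2 :> R by rewrite ltr_wpDl.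
  have : xi L * (m%:R + 2) <= d / 2.
    by rewrite -ler_pdivlMr // -mulrA -invfM.
  rewrite /t; lra.
have lnn : ln n%:R <= ln L.+1%:R :> R by apply: ler_ln_nat => //; apply: leqW.
have lnn1 : ln n.+1%:R <= ln L.+1%:R :> R by exact: ler_ln_nat.
pose B := expR (n%:R * (val_ P + e / 4) + #|{: V}|%:R * (1 + ln n%:R)).
have B0 : 0 <= B by exact: expR_ge0.
have blocks_v v : #|finset (fun w : n.-tuple Sigma => weak_system xi P (v ++ w))|%:R <=
    n.+1%:R ^+ #|{: E}| * B.
  apply: (@card_by_types n v (fun w : n.-tuple Sigma => weak_system xi P (v ++ w)) B B0) => w Xw.
  have sN : (\sum_f edge_count (@shift Sigma m) v w f = n)%N.
    by rewrite sum_edge_countT size_tuple.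
  apply: le_trans (words_of_le R (@shift Sigma m) v n0 sN) _.
  rewrite /B ler_expR lerD2r ler_wpM2l //.
  have nf := near_feasible_empirical n0 Pcube Xw; rewrite -Ln in nf.
  apply: le_trans (HK P _ t t0 fP nf) _.
  by rewrite lerD2l Hd.
rewrite [in leLHS]Ln /weak_blocks (card_tuple_cat _ _ (weak_system xi P)) natr_sum.
apply: le_trans (ler_sum _ (fun v _ => blocks_v v)) _.
rewrite sumr_const -[leLHS]mulr_natl.
have V_le : #|{: V}|%:R <= expR #|{: V}|%:R :> R.
  by apply: le_trans (expR_ge1Dx _); rewrite lerDr.
apply: le_trans (ler_wpM2r _ V_le) _; first by rewrite mulr_ge0 // exprn_ge0.
have -> : n.+1%:R ^+ #|{: E}| = expR (#|{: E}|%:R * ln n.+1%:R) :> R.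
  by rewrite mulrC expRM_natr lnK // posrE ltr0n.
rewrite /B -!expRD ler_expR.
have hC := Hn3 _ n3L.
have L1 : 1 <= L%:R :> R by rewrite ler1n.
have hV : #|{: V}|%:R * ln n%:R <= #|{: V}|%:R * ln L.+1%:R :> R by rewrite ler_wpM2l.
have hE : #|{: E}|%:R * ln n.+1%:R <= #|{: E}|%:R * ln L.+1%:R :> R by rewrite ler_wpM2l.
have lnL : 0 <= ln L.+1%:R :> R by rewrite ln_ge0 // ler1n.
have hV0 : 0 <= #|{: V}|%:R * ln L.+1%:R :> R by rewrite mulr_ge0.
have hnL : n%:R * (val_ P + e / 4) <= L%:R * (val_ P + e / 4).
  by rewrite ler_wpM2r ?ler_nat //; lra.
have eL : e / 4 <= e / 4 * L%:R by rewrite ler_peMr // ltW.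
move: hC; rewrite natrD natrM -natr1.
have E0 : 0 <= #|{: E}|%:R :> R by [].
move: hV hE hV0 hnL eL E0; rewrite mulrDr.
set x1 := #|{: V}|%:R; set x2 := #|{: E}|%:R; set l := ln L.+1%:R.
lra.
Qed.

Lemma blocks_lower P (e : R) (L0 : nat) : unit_cube P -> (feas P !=set0)%classic -> 0 < e ->
  exists2 n, (L0 <= n)%N & expR (n%:R * (val_ P - e)) <= #|weak_blocks xi P n|%:R.
Proof.
move=> Pcube fP e0.
have [p fp hp] : exists2 p, feas P p & val_ P - e / 2 < entropy p.
  apply: contrapT => H.
  suff : val_ P <= val_ P - e / 2 by lra.
  apply: value_le => // p fp; rewrite leNgt; apply/negP => h.
  by apply: H; exists p.
have [pD bal pA] := fp.
have e4 : 0 < e / 4 by rewrite divr_gt0.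
have [f0 _] : exists f : E, true.
  case: (pickP (fun f : E => true)) => [f _|none]; first by exists f.
  have [_] := pD; rewrite big_pred0 // => /esym/eqP; by rewrite oner_eq0.
have s0 : (0 < #|Sigma|)%N by apply/card_gt0P; exists f0.2.
pose v := f0.1.
have val0 : 0 <= val_ P by exact: value_ge0.
(* Beyond [M1], replacing [m + n] by [n] loses at most [1/2] of the tolerance budget
   [2 * |Sigma|^m]. Beyond [M2], the [m] letters of [v], which add length but no entropy, cost at
   most [n * e / 4]. *)
pose M1 := (4 * #|Sigma| ^ m * m)%N.
pose M2 := (Num.truncn (m%:R * val_ P / (e / 4))).+1.
have [k [N [Mk HN words]]] := many_words (@shift_connected Sigma m)
  (@shift_eulerian Sigma m) v (L0 + M1 + M2) pD bal e4.
set c := #|{: E}| in HN words.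
have c0 : (0 < c)%N by apply/card_gt0P; exists f0.
set n := (k + c)%N in words.
have n0 : (0 < n)%N by rewrite addn_gt0 c0 orbT.
have mn0 : (0 < m + n)%N by rewrite addn_gt0 n0 orbT.
have kn : (L0 + M1 + M2 <= n)%N := leq_trans Mk (leq_addr _ _).
have L0n : (L0 <= n)%N by apply: leq_trans kn; rewrite -addnA leq_addr.
have M1n : (M1 <= n)%N by apply: leq_trans kn; rewrite addnAC leq_addl.
have M2n : (M2 <= n)%N by apply: leq_trans kn; rewrite leq_addl.
exists (m + n)%N; first by rewrite (leq_trans L0n) // leq_addl.
have nR : 0 < n%:R :> R by rewrite ltr0n.
have hM2 : m%:R * val_ P <= n%:R * (e / 4).
  rewrite -ler_pdivrMr //; apply/ltW/(lt_le_trans (truncnS_gt _)).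
  by rewrite ler_nat.
apply: (@le_trans _ _ (words_of (@shift Sigma m) n N v)%:R).
  apply: le_trans words; rewrite ler_expR natrD.
  have : n%:R * (val_ P - e / 2 - e / 4) <= n%:R * (entropy p - e / 4).
    by rewrite ler_pM2l //; lra.
  have : 0 <= m%:R * e by rewrite mulr_ge0 // ltW.
  lra.
rewrite ler_nat; apply: words_of_le_blocks => w wN.
have w0 : (0 < size w)%N by rewrite size_tuple.
apply/(weak_system_cat P v w0) => phi; rewrite size_tuple.
have /andP[phi0 phim] := F_size phi; set j := (m.+1 - size (fsval phi))%N.
have /andP[_ le1] := occurrences_leD (fsval phi) (v ++ w) n j.
apply: (@le_trans _ _ (occurrences (fsval phi) (v ++ w) n + j)%:R); first by rewrite ler_nat.
have := sum_edge_count_prefix v w phim; rewrite size_tuple wN => <-.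
rewrite natrD natr_sum.
have sumN : \sum_(f : E | prefix (fsval phi) (edge_word f)) (N f)%:R <=
    k%:R * P phi + (#|Sigma| ^ j)%:R + 4^-1.
  apply: le_trans (ler_sum _ (fun f _ => HN f)) _.
  rewrite big_split big_split /= -mulr_sumr; apply: lerD.
    apply: lerD; first by rewrite ler_wpM2l //; exact: pA.
    by rewrite sumr_const ler_nat; exact: card_prefix_edges.
  apply: (@le_trans _ _ (\sum_(f : E) (4 * c%:R)^-1)).
    rewrite big_mkcond; apply: ler_sum => f _; case: ifP => _; first exact: lexx.
    by rewrite invr_ge0 mulr_ge0.
  have -> : \sum_(f : E) (4 * c%:R)^-1 = c%:R * (4 * c%:R)^-1 :> R.
    by rewrite sumr_const [RHS]mulr_natl.
  by rewrite invfM mulrCA mulfV ?mulr1 ?lexx ?pnatr_eq0 -?lt0n.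
(* The added edge copies and the last [j] positions give an excess of [|Sigma|^j + j]; the extra [1]
   pays for the rounding error [1/4] and the loss [1/2] in [xiL]. *)
have room : (#|Sigma| ^ j)%:R + j%:R + 1 <= 2 * #|Sigma|%:R ^+ m :> R.
  have jm : (j <= m)%N by rewrite leq_subLR -add1n leq_add2r.
  have h1 : (#|Sigma| ^ j <= #|Sigma| ^ m)%N by rewrite leq_pexp2l.
  have h2 := F_room phi; rewrite -/j in h2.
  rewrite -natrX -(natrM _ 2) -addrA natr1 -natrD ler_nat mul2n -addnn.
  exact: leq_add h1 (leq_trans h2 h1).
have xiL : n%:R * xi (m + n) >= 2 * #|Sigma|%:R ^+ m - 2^-1.
  have mnR : 0 < (m + n)%:R :> R by rewrite ltr0n.
  apply: (@le_trans _ _ (n%:R * (2 * #|Sigma|%:R ^+ m * (m + n)%:R^-1))); last first.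
    by rewrite ler_wpM2l // xi_ge.
  rewrite mulrA ler_pdivlMr //.
  have : 4 * #|Sigma|%:R ^+ m * m%:R <= (m + n)%:R :> R.
    by rewrite -natrX -(natrM _ 4) -natrM ler_nat (leq_trans M1n) // leq_addl.
  rewrite natrD; lra.
have /andP[P0 P1] := Pcube phi.
have xi0 : 0 <= xi (m + n) by exact: xi_ge0.
have cP : 0 <= c%:R * P phi by rewrite mulr_ge0.
have jP : 0 <= j%:R * P phi by rewrite mulr_ge0.
have jxi : 0 <= j%:R * xi (m + n) by rewrite mulr_ge0.
have nE : n%:R = k%:R + c%:R :> R by rewrite /n natrD.
move: xiL; rewrite natrD nE !mulrDl !mulrDr.
move: sumN room cP jP jxi; lra.
Qed.

(** The upper bound holds at all large lengths, the lower one at infinitely many, which suffices for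
    an upper limit. *)
Lemma weak_capacityE P : unit_cube P -> (feas P !=set0)%classic ->
  weak_capacity xi P = (val_ P / ln 2)%:E.
Proof.
move=> Pcube fP; have ln2 : 0 < ln 2 :> R by rewrite ln_gt0 // ltr1n.
apply/le_anti/andP; split.
  apply/lee_addgt0Pr => e e0; rewrite -EFinD.
  have eln : 0 < e * ln 2 by rewrite mulr_gt0.
  have [n0 Hn0] := blocks_upper Pcube fP eln.
  apply: (@limn_esup_le _ _ _ n0.+1) => n nn.
  have -> : val_ P / ln 2 + e = (val_ P + e * ln 2) / ln 2.
    by rewrite mulrDl mulfK // gt_eqF.
  by apply: log2_rate_le; [lia | apply: Hn0; lia].
apply/lee_subgt0Pr => e e0; rewrite -EFinB.
have eln : 0 < e * ln 2 by rewrite mulr_gt0.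
apply: limn_esup_ge => n0.
have [n nn Hn] := blocks_lower n0.+1 Pcube fP eln.
exists n; first lia.
have -> : val_ P / ln 2 - e = (val_ P - e * ln 2) / ln 2.
  by rewrite mulrBl mulfK // gt_eqF.
by apply: log2_rate_ge => //; lia.
Qed.

End Blocks.

Local Open Scope classical_set_scope.
Local Open Scope ring_scope.

(** * Reduced sets of words and the main theorem *)

Section WordSets.
Variables (Sigma : finType) (F : {fset seq Sigma}).

Lemma size_le_max_length (phi : F) : (size (fsval phi) <= max_length F)%N.
Proof. by rewrite /max_length (@leq_bigmax_seq _ _ xpredT size) ?fsvalP. Qed.

Lemma max_length_attained : (0 < max_length F)%N ->
  exists2 psi, psi \in F & size psi = max_length F.
Proof.
rewrite /max_length.
have in_F psi : psi \in enum_fset F -> psi \in F by [].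
elim: (enum_fset F) in_F => [|phi s IH] in_F; first by rewrite big_nil.
rewrite big_cons; set M := bigop _ _ _.
rewrite /maxn; case: ifP => _ M0.
  by apply: IH => // psi psis; apply: in_F; rewrite inE psis orbT.
by exists phi => //; apply: in_F; rewrite mem_head.
Qed.

Hypothesis F_reduced : reduced F.

(** Otherwise the empty word of [F] would be a proper subword of a longest one. *)
Lemma reduced_size_gt0 (phi : F) : (0 < max_length F)%N -> (0 < size (fsval phi))%N.
Proof.
move=> /[dup] k0 /max_length_attained [psi psiF sz].
rewrite lt0n; apply/eqP => /size0nil phi0.
have : [::] \notin F.
  apply: (F_reduced psiF); rewrite /proper_subword infix0s.
  by apply/eqP => psi0; move: sz k0; rewrite -psi0 => <-.
by rewrite -phi0 fsvalP.
Qed.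

(** All words are powers of one letter, so a shorter word of [F] would be a proper prefix of a
    longest one. *)
Lemma reduced_unary (phi : F) : (#|Sigma| <= 1)%N -> size (fsval phi) = max_length F.
Proof.
move=> s1; have [k0|k0] := posnP (max_length F).
  by apply/eqP; rewrite eqn_leq size_le_max_length k0.
have [psi psiF sz] := max_length_attained k0.
have phi0 := reduced_size_gt0 phi k0.
have [a _] : exists a : Sigma, true by case: (fsval phi) phi0 => // a; exists a.
have unary (w : seq Sigma) : w = nseq (size w) a.
  by apply/all_pred1P/allP => b _; apply/eqP; exact: (fintype_le1P s1).
apply/eqP; rewrite eqn_leq size_le_max_length /= leqNgt; apply/negP => lt.
have : fsval phi \notin F.
  apply: (F_reduced psiF); rewrite /proper_subword; apply/andP; split.
    rewrite (unary psi) (unary (fsval phi)) sz -(subnKC (ltnW lt)) nseqD.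
    exact/prefixW/prefix_prefix.
  by apply/eqP => E; move: lt; rewrite -sz E ltnn.
by rewrite fsvalP.
Qed.

Lemma reduced_room (phi : F) m : max_length F = m.+1 ->
  ((m.+1 - size (fsval phi)).+1 <= #|Sigma| ^ (m.+1 - size (fsval phi)))%N.
Proof.
move=> km; case: (leqP #|Sigma| 1) => [/(reduced_unary phi)|]; last exact: ltn_expl.
by rewrite km => ->; rewrite subnn expn0.
Qed.

Variable R : realType.
Implicit Types P : F -> R.

(* [Gamma] with its word length generalized, so that one can destruct it. *)
Definition Gamma_of k P : set (k.-tuple Sigma -> R) :=
  [set nu | [/\ probability_weights nu, shift_invariant nu &
     forall phi : F, \sum_(w : k.-tuple Sigma | prefix (val phi) w) nu w <= P phi]].

(** Along the bijection [edge_word], shift invariance becomes balance at every vertex. *)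
Lemma feasible_Gamma_of m P : Gamma_of (k := m.+1) P !=set0 ->
  feasible (@shift Sigma m) (@begins_with Sigma F m) P !=set0.
Proof.
move=> [nu [[nu0 nu1] inv nuP]].
have edge_bij : bijective (@edge_word Sigma m).
  apply: inj_card_bij; first exact: edge_word_inj.
  by rewrite card_prod !card_tuple expnSr.
exists (nu \o @edge_word Sigma m); split=> [|x|phi].
- split=> [e|]; first exact: nu0.
  by rewrite -nu1 [RHS](reindex (@edge_word Sigma m)) //; exact: onW_bij.
- rewrite /in_weight (sum_in_edge (nu \o @edge_word Sigma m)) /out_weight.
  transitivity (\sum_a nu [tuple of a :: x]); first by rewrite inv.
  by apply: eq_bigr => a _; congr nu; apply: val_inj; rewrite [RHS]edge_word_in_edge.
- have := nuP phi; rewrite (reindex (@edge_word Sigma m)) //; exact: onW_bij.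
Qed.

Lemma weak_capacity_length0 (xi : nat -> R) P Q : (forall n, 0 < xi n) ->
  max_length F = 0%N -> Gamma_of (k := 0) P !=set0 -> Gamma_of (k := 0) Q !=set0 ->
  weak_capacity xi P = weak_capacity xi Q.
Proof.
move=> xi0 k0.
have size0 (phi : F) : size (fsval phi) = 0%N.
  by apply/eqP; rewrite -leqn0 -k0 size_le_max_length.
have frequency1 (phi : F) w : frequency R (val phi) w <= 1.
  rewrite frequencyE ?size0 // ler_pdivrMr ?ltr0n // mul1r ler_nat subn0.
  rewrite -[leqRHS]card_ord -[leqRHS]sum1_card.
  by apply: leq_sum => i _; exact: leq_b1.
have full P' n : Gamma_of (k := 0) P' !=set0 -> weak_blocks xi P' n = finset.setT.
  move=> [nu [[_ nu1] _ nuP]]; apply/setP => w; rewrite !inE; apply/forallP => phi.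
  apply: le_trans (frequency1 phi w) _.
  have : 1 <= P' phi.
    apply: le_trans (nuP phi); rewrite -nu1 le_eqVlt; apply/orP; left; apply/eqP.
    have -> : val phi = [::] := size0nil (size0 phi).
    by apply: eq_bigl => u; rewrite prefix0s.
  by have := xi0 (size w); lra.
move=> gP gQ; congr limn_esup; apply/funext => n; by rewrite !full.
Qed.

(** Since [F] is finite, pointwise convergence is uniform. *)
Lemma nbhs_ptws_ball (d : R) : 0 < d ->
  \forall eps \near nbhs (0 : {ptws F -> R}), forall phi, `|eps phi| <= d.
Proof.
move=> d0; apply: filter_forall => phi.
apply: (@proj_continuous F (fun=> R) phi 0 [set x | `|x| <= d]).
by apply/nbhs_ballP; exists d => // x; rewrite /ball /= sub0r normrN => /ltW.
Qed.

End WordSets.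

Lemma tolerance_small (R : realType) (xi : nat -> R) : tolerance xi ->
  forall e : R, 0 < e -> exists n0 : nat, forall n, (n0 <= n)%N -> xi n <= e.
Proof.
move=> [xi0 xi_o _] e e0.
have /eqoP/(_ e e0) [n0 _ H] := xi_o.
exists n0 => n nn; have := H n nn; rewrite /= normr1 mulr1 gtr0_norm //.
Qed.

Theorem mainTheorem8 (R : realType) (Sigma : finType) (F : {fset seq Sigma})
    (F_reduced : reduced F) (xi : nat -> R) (xi_tolerance : tolerance xi)
    (xi_ge : forall n : nat, (0 < n)%N ->
       2 * #|Sigma|%:R ^+ (max_length F).-1 * n%:R^-1 <= xi n)
    (P : F -> R) (P_cube : unit_cube P) (P_feasible : Gamma P !=set0) :
  weak_capacity xi (P \+ eps) @[eps --> within
      [set eps : F -> R | unit_cube (P \+ eps) /\ Gamma (P \+ eps) !=set0]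
      (nbhs (0 : {ptws F -> R}))]
    --> weak_capacity xi P.
Proof.
have xi0 : forall n, 0 < xi n by case: xi_tolerance.
have Gamma_len k (Q : F -> R) : max_length F = k -> Gamma Q !=set0 -> Gamma_of (k := k) Q !=set0.
  by move=> <-.
pose D := [set eps : F -> R | unit_cube (P \+ eps) /\ Gamma (P \+ eps) !=set0].
have N0 : Filter (nbhs (0 : {ptws F -> R})) := nbhs_filter _.
have D_filter : Filter (within D (nbhs (0 : {ptws F -> R}))) := within_filter D N0.
have D_near : within D (nbhs (0 : {ptws F -> R})) D := withinT D N0.
have [k k_eq] : exists k, max_length F = k by exists (max_length F).
(* Words of length [k - 1] as vertices require [k > 0]; for [k = 0] the capacity is constant on the
   domain of the limit. *)
case: k k_eq => [|m] k_eq.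
  apply: (@cvg_near_cst _ _ _ _ _ D_filter); apply: filterS D_near => eps [_ feas].
  by apply: weak_capacity_length0 => //; exact: Gamma_len.
have F_size (phi : F) : (0 < size (fsval phi) <= m.+1)%N.
  by rewrite reduced_size_gt0 ?k_eq //= -k_eq size_le_max_length.
have F_room (phi : F) := reduced_room F_reduced phi k_eq.
rewrite k_eq /= in xi_ge.
have capE Q : unit_cube Q -> Gamma Q !=set0 ->
    weak_capacity xi Q = (value (@shift Sigma m) (@begins_with Sigma F m) Q / ln 2)%:E.
  move=> Qcube Qfeas.
  apply: weak_capacityE => //; first exact: tolerance_small.
  exact/feasible_Gamma_of/Gamma_len.
have ln2 : 0 < ln 2 :> R by rewrite ln_gt0 // ltr1n.
(* On this domain the capacity is finite, so the limit can be taken in the reals. *)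
rewrite capE //; apply: (cvg_EFin (FF := D_filter)).
  by apply: filterS D_near => eps [cube feas]; rewrite capE.
apply/(@cvgrPdist_le _ _ _ _ D_filter) => e e0.
have [K K0 HK] := value_sqrt_modulus R (@shift Sigma m) (@begins_with Sigma F m).
have eln : 0 < e * ln 2 by rewrite mulr_gt0.
have [d d0 Hd] := sqrt_small K0 eln.
have D_small : within D (nbhs (0 : {ptws F -> R})) [set eps | forall phi, `|eps phi| <= d].
  by apply: filterS (nbhs_ptws_ball F d0) => eps small _.
apply: filterS (filterI D_near D_small) => eps [[cube feas] small].
rewrite /= capE //= -mulrBl normrM [X in _ * X]gtr0_norm ?invr_gt0 //.
rewrite ler_pdivrMr //; apply: le_trans (Hd d (lexx d)).
apply: HK; rewrite ?ltW //.
- exact/feasible_Gamma_of/Gamma_len.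
- exact/feasible_Gamma_of/Gamma_len.
- by move=> phi; rewrite /= opprD addrA subrr add0r normrN.
Qed.
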